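(* Let $k\ge1$, $\Delta t>0$, and let functions $\phi_1^n,\dots,\phi_k^n$, a real number $r^n$ and functions $\bar\phi_1^{n+1/2},\dots,\bar\phi_k^{n+1/2}$ be given, where $\bar\phi_j^{n+1/2}$ is any second-order explicit approximation of $\phi_j(t^{n+1/2})$ (i.e. computed from previous time levels only, with error $O(\Delta t^2)$). Write $\bar{\mathcal E}_1=\mathcal E_1[\bar\phi_1^{n+1/2},\dots,\bar\phi_k^{n+1/2}]$ and $\bar U_i=U_i[\bar\phi_1^{n+1/2},\dots,\bar\phi_k^{n+1/2}]$. Consider the SAV/CN scheme for the unknowns $(\phi_i^{n+1},\mu_i^{n+1/2})_{1\le i\le k}$ and $r^{n+1}$: for $i=1,\dots,k$, $$\frac{\phi_i^{n+1}-\phi_i^n}{\Delta t}=\mathcal G\mu_i^{n+1/2},$$ $$\mu_i^{n+1/2}=\frac12\sum_{j=1}^kd_{ij}\mathcal L(\phi_j^{n+1}+\phi_j^n)+\frac{\bar U_i}{2\sqrt{\bar{\mathcal E}_1}}(r^{n+1}+r^n),$$ $$r^{n+1}-r^n=\int_\Omega\sum_{j=1}^k\frac{\bar U_j}{2\sqrt{\bar{\mathcal E}_1}}(\phi_j^{n+1}-\phi_j^n)\,d\boldsymbol x .$$ Then: (1) The scheme is second-order accurate, in the sense of consistency: if $(\phi_i,\mu_i,r)$ is a sufficiently smooth exact solution of the reformulated gradient flow (given in the context), and one substitutes $\phi_i(t^n),\phi_i(t^{n+1}),\mu_i(t^{n+1/2}),r(t^n),r(t^{n+1})$ into the scheme (the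 last equation being divided by $\Delta t$), with $\bar\phi_j^{n+1/2}=\phi_j(t^{n+1/2})+O(\Delta t^2)$, then the residuals of all equations are $O(\Delta t^2)$ as $\Delta t\to0$. (2) The scheme is unconditionally energy stable: for every $\Delta t>0$, every solution of the scheme satisfies $$\frac1{\Delta t}\Big[\frac12\sum_{i,j=1}^kd_{ij}(\mathcal L\phi_j^{n+1},\phi_i^{n+1})+(r^{n+1})^2\Big]-\frac1{\Delta t}\Big[\frac12\sum_{i,j=1}^kd_{ij}(\mathcal L\phi_j^{n},\phi_i^{n})+(r^n)^2\Big]=\sum_{i=1}^k(\mathcal G\mu_i^{n+1/2},\mu_i^{n+1/2})\ (\le0).$$ (3) Let $\lambda_1,\dots,\lambda_k>0$ be the eigenvalues of the matrix $D=(\frac{\Delta t}{2}d_{ij})_{1\le i,j\le k}$. One can obtain $r^{n+1}$ and $(\phi_j^{n+1},\mu_j^{n+1/2})_{1\le j\le k}$ by solving two sequences of decoupled linear equations with constant coefficients of the form $$\psi_i-\lambda_i\mathcal G\mathcal L\psi_i=g_i,\qquad i=1,\dots,k .$$ That is, with $E$ an orthogonal matrix of eigenvectors, $D=E\,\mathrm{diag}(\lambda_1,\dots,\lambda_k)E^T$, there are two families of right-hand sides $(g_i^{(1)})_i,(g_i^{(2)})_i$ determined explicitly by the given data such that, with $\psi^{(1)},\psi^{(2)}$ the vectors of corresponding solutions, $(\phi_1^{n+1},\dots,\phi_k^{n+1})^T=E\psi^{(1)}+s\,E\psi^{(2)}$, where $s\in\mathbb R$ is given explicitly through inner products of $E\psi^{(1)},E\psi^{(2)}$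 with known functions, and then $r^{n+1}$ and $\mu_i^{n+1/2}$ are given by the third and second equations of the scheme.
   Context: Setting: $\Omega$ is a domain, $(\phi,\psi)=\int_\Omega\phi\psi\,d\boldsymbol x$. Boundary conditions (e.g. periodic or homogeneous Neumann) are such that all boundary terms vanish when integrating by parts. $\mathcal G$ is a linear, symmetric, non-positive operator independent of the unknowns ($(\mu,\mathcal G\mu)\le0$); $\mathcal L$ is a linear, self-adjoint, non-negative operator independent of the unknowns; $(d_{ij})_{1\le i,j\le k}$ is a constant real symmetric positive definite matrix. The free energy is $$\mathcal E[\phi_1,\dots,\phi_k]=\frac12\sum_{i,j=1}^kd_{ij}(\phi_i,\mathcal L\phi_j)+\mathcal E_1[\phi_1,\dots,\phi_k],$$ where the (sufficiently smooth) nonlinear functional $\mathcal E_1$ satisfies $\mathcal E_1\ge C_1>0$, and $U_i=\delta\mathcal E_1/\delta\phi_i$ are its variational derivatives. All functions are assumed regular enough that the expressions written make sense, and linear equations of the form $\psi-\lambda\mathcal G\mathcal L\psi=g$, $\lambda>0$, are assumed to be uniquely solvable. With the scalar auxiliary variable $r(t)=\sqrt{\mathcal E_1[\phi_1(t),\dots,\phi_k(t)]}$, the gradient flow $\partial_t\phi_i=\mathcal G\,\delta\mathcal E/\delta\phi_i$ is reformulated as $$\partial_t\phi_i=\mathcal G\mu_i,\qquad \mu_i=\sum_{j=1}^kd_{ij}\mathcal L\phi_j+\frac{r}{\sqrt{\mathcal E_1}}U_i,\qquad r_t=\frac1{2\sqrt{\mathcal E_1}}\int_\Omega\sum_{i=1}^kU_i\,\partial_t\phi_i\,d\boldsymbol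 x .$$ Time levels: $t^n=n\Delta t$, $t^{n+1/2}=(n+\frac12)\Delta t$; $\phi_i^n$ and $r^n$ approximate $\phi_i(t^n)$ and $r(t^n)$. *)

(* Defs.v *)
From HB Require Import structures.
From mathcomp Require Import all_boot all_order all_algebra.
From mathcomp Require Import all_classical all_reals all_analysis.

Set Implicit Arguments.
Unset Strict Implicit.
Unset Printing Implicit Defensive.

Import Order.TTheory GRing.Theory Num.Theory.
Import numFieldNormedType.Exports.

Local Open Scope classical_set_scope.
Local Open Scope ring_scope.

Definition borel_rV (R : realType) (m : nat) :=
  g_sigma_algebraType (@open 'rV[R]_m).

(* MathComp-Analysis only provides the Lebesgue measure on the line; on R^m it
   is the unique Borel measure that gives each closed box its volume *)
Definition is_lebesgue_measure (R : realType) (m : nat)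
    (nu : {measure set (borel_rV R m) -> \bar R}) : Prop :=
  forall a b : 'rV[R]_m, (forall i, a 0 i <= b 0 i) ->
    nu [set x : 'rV[R]_m | forall i, a 0 i <= x 0 i <= b 0 i] =
      (\prod_i (b 0 i - a 0 i))%:E.

Definition is_domain (R : realType) (m : nat) (Omega : set 'rV[R]_m) : Prop :=
  [/\ open Omega, connected Omega & Omega !=set0].

Section FunctionSpace.
Context (R : realType) (m : nat) (Omega : set 'rV[R]_m).
Context (nu : {measure set (borel_rV R m) -> \bar R}).
Context (V : normedModType R) (ev : V -> 'rV[R]_m -> R).

Definition inner (f g : V) : R :=
  \int[nu]_(x in Omega) (ev f x * ev g x).

Definition L2norm (f : V) : R := Num.sqrt (inner f f).

Definition inner_sum (k : nat) (u v : 'I_k -> V) : R :=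
  \int[nu]_(x in Omega) (\sum_(j < k) ev (u j) x * ev (v j) x).

(* V is the space of admissible functions: real functions on Omega (ev f x is
   the value f(x), which is irrelevant for x outside Omega) that satisfy the
   boundary conditions and are as regular as needed.  They are square
   integrable.  The norm of V is the one in which regularity in time and
   perturbations of the arguments of E_1 are measured: it may be any norm that
   dominates the L^2 norm, e.g. L^2 itself, a Sobolev norm or a C^p norm.
   V need not be complete, and the operators need not be continuous. *)
Record function_space : Prop := FunctionSpace {
  ev_linear : forall (a : R) (f g : V) x, Omega x ->
    ev (a *: f + g) x = a * ev f x + ev g x;
  ev_injective : forall f g : V,
    (forall x, Omega x -> ev f x = ev g x) -> f = g;
  ev_measurable : forall f : V,
    measurable_fun (Omega : set (borel_rV R m)) (ev f);
  ev_square_integrable : forall f : V,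
    nu.-integrable Omega (fun x => ((ev f x) ^+ 2)%:E);
  L2norm_le_norm : exists C : R, forall f : V, L2norm f <= C * `|f|
}.

Definition symmetric_op (A : V -> V) : Prop :=
  forall f g, inner (A f) g = inner f (A g).

Definition nonpositive_op (A : V -> V) : Prop := forall f, inner f (A f) <= 0.

Definition nonnegative_op (A : V -> V) : Prop := forall f, 0 <= inner f (A f).

Context (k : nat).

(* U i = (delta E_1 / delta phi_i), the L^2 gradient of E_1 in its i-th
   argument *)
Definition is_variational_derivative
    (E1 : ('I_k -> V) -> R) (U : 'I_k -> ('I_k -> V) -> V) : Prop :=
  forall (phi : 'I_k -> V) (i : 'I_k) (eta : V),
    is_derive (0 : R) (1 : R)
      (fun eps : R =>
         E1 (fun j => if j == i then phi j + eps *: eta else phi j) : R^o)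
      (inner (U i phi) eta).

Definition locally_lipschitz_L2 (F : ('I_k -> V) -> V) : Prop :=
  forall phi : 'I_k -> V, exists rho K : R, 0 < rho /\
    forall phi1 phi2 : 'I_k -> V,
      (forall j, `|phi1 j - phi j| < rho) ->
      (forall j, `|phi2 j - phi j| < rho) ->
      L2norm (F phi1 - F phi2) <= K * \sum_(j < k) `|phi1 j - phi2 j|.

End FunctionSpace.

Definition positive_definite (R : realType) (k : nat) (d : 'M[R]_k) : Prop :=
  forall x : 'cV[R]_k, x != 0 -> 0 < (x^T *m d *m x) 0 0.

(* p times differentiable in time on ]0, T[ with a bounded p-th derivative, and
   continuous up to t = 0 and t = T; weaker than C^p([0, T]) *)
Definition smooth_in_time (R : realType) (W : normedModType R)
    (p : nat) (T : R) (f : R -> W) : Prop :=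
  [/\ {within `[0, T], continuous f},
      forall (j : nat) t, (j < p)%N -> 0 < t < T -> derivable (derive1n j f) t 1 &
      exists M : R, forall t, 0 < t < T -> `|derive1n p f t| <= M].

(* e dt n = O(dt^2) as dt -> 0, uniformly over the time steps
   [n dt, (n+1) dt] contained in [0, T] *)
Definition second_order (R : realType) (T : R) (e : R -> nat -> R) : Prop :=
  exists C delta : R, 0 < delta /\
    forall (dt : R) (n : nat), 0 < dt < delta -> n.+1%:R * dt <= T ->
      `|e dt n| <= C * dt ^+ 2.

Section Scheme.
Context (R : realType) (m : nat) (Omega : set 'rV[R]_m).
Context (nu : {measure set (borel_rV R m) -> \bar R}).
Context (V : normedModType R) (ev : V -> 'rV[R]_m -> R).
Context (k : nat) (G L : V -> V) (d : 'M[R]_k).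
Context (E1 : ('I_k -> V) -> R) (U : 'I_k -> ('I_k -> V) -> V).

Local Notation ip := (inner Omega nu ev).

Definition reformulated_flow (T : R) (phi mu : 'I_k -> R -> V) (r : R -> R)
    : Prop :=
  forall t, 0 < t < T ->
  let phit := fun j => phi j t in
  [/\ forall i, is_derive t (1 : R) (phi i) (G (mu i t)),
      forall i, mu i t = \sum_(j < k) d i j *: L (phi j t)
                         + (r t / Num.sqrt (E1 phit)) *: U i phit &
      is_derive t (1 : R) (r : R -> R^o)
        (1 / (2 * Num.sqrt (E1 phit)) *
          inner_sum Omega nu ev (fun i => U i phit) (fun i => derive1 (phi i) t))].

(* \bar U_i / (2 sqrt \bar E_1) *)
Definition half_b (phib : 'I_k -> V) (i : 'I_k) : V :=
  (2 * Num.sqrt (E1 phib))^-1 *: U i phib.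

(* The third equation of the scheme is divided by dt in residual_r *)
Definition residual_phi (dt : R) (phi phi' mu : 'I_k -> V) (i : 'I_k) : V :=
  dt^-1 *: (phi' i - phi i) - G (mu i).

Definition residual_mu (phib phi phi' mu : 'I_k -> V) (r r' : R)
    (i : 'I_k) : V :=
  mu i - (2^-1 *: \sum_(j < k) d i j *: L (phi' j + phi j)
          + (r' + r) *: half_b phib i).

Definition residual_r (dt : R) (phib phi phi' : 'I_k -> V) (r r' : R) : R :=
  (r' - r) / dt
  - inner_sum Omega nu ev (half_b phib) (fun j => phi' j - phi j) / dt.

(* phi, r: values at t^n; phi', r': values at t^{n+1}; mu, phib: values at
   t^{n+1/2} *)
Definition sav_cn (dt : R) (phib phi : 'I_k -> V) (r : R)
    (phi' mu : 'I_k -> V) (r' : R) : Prop :=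
  [/\ forall i, dt^-1 *: (phi' i - phi i) = G (mu i),
      forall i, mu i = 2^-1 *: \sum_(j < k) d i j *: L (phi' j + phi j)
                       + (r' + r) *: half_b phib i &
      r' - r = inner_sum Omega nu ev (half_b phib) (fun j => phi' j - phi j)].

Definition sav_energy (phi : 'I_k -> V) (r : R) : R :=
  2^-1 * (\sum_(i < k) \sum_(j < k) d i j * ip (L (phi j)) (phi i)) + r ^+ 2.

Definition orthogonally_diagonalizes (D E : 'M[R]_k) (lam : 'I_k -> R) : Prop :=
  E^T *m E = 1%:M /\ D = E *m diag_mx (\row_i lam i) *m E^T.

(* E psi, for a matrix E and a vector psi of functions *)
Definition mxact (E : 'M[R]_k) (psi : 'I_k -> V) (i : 'I_k) : V :=
  \sum_(j < k) E i j *: psi j.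

(* Eliminating mu^{n+1/2} and r^{n+1} from the scheme gives, with b = half_b and
   D = (dt / 2) d,
     phi_i' - sum_j D_ij G L phi_j' = c_i + s dt G b_i,  s = sum_j (b_j, phi_j'),
     c_i = phi_i + sum_j D_ij G L phi_j + dt (2 r - sum_j (b_j, phi_j)) G b_i.
   The right-hand sides of the decoupled equations are E^T c and E^T (dt G b),
   and s comes from pairing phi' = E psi1 + s E psi2 with b. *)
Definition rhs1 (dt : R) (phib phi : 'I_k -> V) (r : R) (E : 'M[R]_k)
    : 'I_k -> V :=
  mxact E^T (fun i =>
    phi i + \sum_(j < k) (dt / 2 * d i j) *: G (L (phi j))
    + (dt * (2 * r - \sum_(j < k) ip (half_b phib j) (phi j)))
        *: G (half_b phib i)).

Definition rhs2 (dt : R) (phib : 'I_k -> V) (E : 'M[R]_k) : 'I_k -> V :=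
  mxact E^T (fun i => dt *: G (half_b phib i)).

Definition coef_num (phib : 'I_k -> V) (E : 'M[R]_k) (psi1 : 'I_k -> V) : R :=
  \sum_(j < k) ip (half_b phib j) (mxact E psi1 j).

Definition coef_den (phib : 'I_k -> V) (E : 'M[R]_k) (psi2 : 'I_k -> V) : R :=
  1 - \sum_(j < k) ip (half_b phib j) (mxact E psi2 j).

End Scheme.

(* Main.v *)
(* Consistency: Taylor expansion about t^{n+1/2} settles the linear terms.  In a
   space V that need not be complete, the remainders are estimated with the mean
   value inequality for V-valued functions.  The nonlinear terms need
   half_b = U / (2 sqrt E_1) to be bounded and Lipschitz for the L^2 norm,
   uniformly in a neighbourhood of the trajectory: E_1 is locally Lipschitz
   because its partial derivatives are pairings with the locally bounded U_i,
   and the trajectory is compact.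

   Stability: pair mu_i with phi_i^{n+1} - phi_i^n; the mixed terms cancel since
   d and L are symmetric.

   Solvability: eliminating mu and r^{n+1} leaves
     phi' - D G L phi' = c + s dt G b,  s = (b, phi'),
   which E^T diagonalizes.  The coefficient 1 - (b, E psi2) of the scalar
   equation for s is at least 1 because G <= 0 and D L >= 0. *)
Require Import Defs.
From HB Require Import structures.
From mathcomp Require Import all_boot all_order all_algebra.
From mathcomp Require Import all_classical all_reals all_analysis.
From mathcomp Require Import measurable_realfun ring lra.
From mathcomp.real_closed Require Import complex.

Set Implicit Arguments.
Unset Strict Implicit.
Unset Printing Implicit Defensive.

Import Order.TTheory GRing.Theory Num.Theory.
Import numFieldNormedType.Exports.

Local Open Scope classical_set_scope.
Local Open Scope ring_scope.

(** * Real symmetric matrices *)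

(** Since [G] and [L] need not be continuous, no operator is ever applied to a small remainder:
    [G mu] at the midpoint is exactly the time derivative of [phi], and [L phi] has a smoothness
    hypothesis of its own. Errors of [phi] and [L phi] are estimated in the norm of [V] and passed
    to [L2norm] only at the end, where Cauchy-Schwarz handles the pairings.

    Derivatives in time exist on []0, T[] only, while the first step starts at [0] and the last one
    may end at [T]. Expansions are therefore centred at the midpoint, and at the ends of a step
    continuity has to suffice.

    Part (3) is an equivalence: the eliminated system is equivalent to the scheme, and uniqueness
    for each scalar equation forces every solution into the stated form.

    The matrix [E] has to be real. A unitary diagonalization over the complex numbers may have
    complex eigenvectors, so only one real eigenvalue is taken from it; real eigenvectors are then
    split off one at a time by reflections. *)

Lemma sym_real_eigenvalue (R : rcfType) n (A : 'M[R]_n) :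
  (0 < n)%N -> A^T = A -> exists a, eigenvalue A a.
Proof.
move=> n_gt0 symA; pose f := real_complex R.
pose C : numClosedFieldType := complex R.
pose B : 'M[C]_n := map_mx f A.
have Bherm : B \is hermsymmx.
  apply/is_hermitianmxP; rewrite expr0 scale1r; apply/matrixP => i j.
  by rewrite !mxE -{1}symA mxE /Num.conj /= oppr0.
have BE := orthomx_spectralP (hermitian_normalmx Bherm).
pose i0 := Ordinal n_gt0.
have /mxOverP/(_ 0 i0) realD := hermitian_spectral_diag_real Bherm.
have [a Da] : exists a, spectral_diag B 0 i0 = f a.
  move/CrealP: realD; case: (spectral_diag B 0 i0) => x y.
  rewrite /Num.conj /= => -[yN]; exists x; congr complex.Complex; lra.
(* Being an eigenvalue does not depend on the field, so a complex eigenvector is enough.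
   Eigenvectors are rows here: with [P = spectralmx B] one has [P B = diag P], so any row of the
   invertible [P] qualifies. *)
exists a; rewrite -(eigenvalue_map f); apply/eigenvalueP.
exists (row i0 (spectralmx B)); last first.
  apply: contraL (spectral_unit B) => /eqP P0.
  by apply/negP => /mulmxV/(congr1 (row i0)); rewrite row_mul P0 mul0mx
   => /rowP/(_ i0)/esym/eqP; rewrite !mxE eqxx oner_eq0.
rewrite -/B {2}BE -row_mul !mulmxA mulmxV ?spectral_unit// mul1mx.
by rewrite row_mul row_diag_mx Da -scalemxAl -rowE.
Qed.

Section Householder.
Variables (R : realFieldType) (n : nat).
Implicit Types v w : 'cV[R]_n.

Lemma cV_norm_ge0 v : 0 <= (v^T *m v) 0 0.
Proof. by rewrite mxE sumr_ge0// => i _; rewrite mxE -expr2 sqr_ge0. Qed.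

Lemma cV_norm_eq0 v : ((v^T *m v) 0 0 == 0) = (v == 0).
Proof.
apply/idP/eqP => [|->]; last by rewrite mulmx0 mxE.
rewrite mxE psumr_eq0 => [/allP v0|i _]; last by rewrite mxE -expr2 sqr_ge0.
apply/colP => i; have /implyP/(_ isT) := v0 i (mem_index_enum _).
by rewrite !mxE -expr2 sqrf_eq0 => /eqP.
Qed.

(* The Householder reflection in the hyperplane orthogonal to v - w. *)
Lemma exists_reflection v w : v^T *m v = w^T *m w ->
  exists Q : 'M[R]_n, [/\ Q^T *m Q = 1%:M & Q *m v = w].
Proof.
have [->|vw] := eqVneq v w; first by exists 1%:M; rewrite trmx1 !mul1mx.
move=> nvw; pose u := v - w; pose c := (u^T *m u) 0 0.
have c0 : c != 0 by rewrite cV_norm_eq0 subr_eq0.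
have uu : u^T *m u = c%:M by rewrite -mx11_scalar.
exists (1%:M - (2 / c) *: (u *m u^T)).
have symQ : (1%:M - (2 / c) *: (u *m u^T))^T = 1%:M - (2 / c) *: (u *m u^T).
  by rewrite linearB linearZ /= trmx1 trmx_mul trmxK.
split.
  have PP : u *m u^T *m (u *m u^T) = c *: (u *m u^T).
    by rewrite mulmxA -(mulmxA u) uu scalar_mxC mul_scalar_mx scalemxAl.
  rewrite symQ mulmxBl mul1mx mulmxBr mulmx1 -scalemxAl -scalemxAr PP !scalerA.
  rewrite -addrA -opprD -scalerBl -scalerDl.
  have -> : 2 / c + (2 / c - 2 / c * (2 / c) * c) = 0 by field.
  by rewrite scale0r subr0.
(* Equal norms give [|u|^2 = 2 (|v|^2 - v.w) = 2 u.v]; hence the reflection subtracts exactly [u]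
   from [v]. *)
have uv : u^T *m v = (c / 2)%:M.
  rewrite [LHS]mx11_scalar; congr (_%:M).
  have wv : (w^T *m v) 0 0 = (v^T *m w) 0 0.
    by rewrite -[in LHS](trmxK v) -trmx_mul mxE.
  have -> : c = (v^T *m v) 0 0 - (v^T *m w) 0 0
              - ((w^T *m v) 0 0 - (w^T *m w) 0 0).
    by rewrite /c /u [(v - w)^T]linearB /= mulmxBl !mulmxBr !mxE; ring.
  have -> : (u^T *m v) 0 0 = (v^T *m v) 0 0 - (w^T *m v) 0 0.
    by rewrite /u [(v - w)^T]linearB /= mulmxBl !mxE.
  by rewrite -nvw wv; field.
rewrite mulmxBl mul1mx -scalemxAl -mulmxA uv mul_mx_scalar scalerA.
by rewrite mulrA divfK// divff ?pnatr_eq0// scale1r /u subKr.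
Qed.
End Householder.

(** Deflation: a reflection [Q] carrying the first basis vector [e] to a unit eigenvector turns [A]
    into [Q^T A Q], which splits off a 1 x 1 block; the induction hypothesis diagonalizes the
    remaining block. *)
Lemma real_symmetric_diagonalizable (R : rcfType) n (A : 'M[R]_n) : A^T = A ->
  exists (E : 'M[R]_n) (lam : 'rV[R]_n),
    E^T *m E = 1%:M /\ A = E *m diag_mx lam *m E^T.
Proof.
elim: n A => [|n IHn] A symA.
  by exists 1%:M, 0; split; apply/matrixP => -[].
move: A symA; rewrite -[n.+1]/(1 + n)%N => A symA.
have [a /eigenvalueP[u uA u0]] := sym_real_eigenvalue (ltn0Sn n) symA.
pose c := (u *m u^T) 0 0.
have c_gt0 : 0 < c.
  have cE : c = ((u^T)^T *m u^T) 0 0 by rewrite trmxK.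
  by rewrite lt_def cE cV_norm_ge0 cV_norm_eq0 -trmx0 (inj_eq trmx_inj) u0.
pose v := (Num.sqrt c)^-1 *: u^T.
have vv : v^T *m v = 1%:M.
  rewrite /v [(_ *: u^T)^T]linearZ /= trmxK -scalemxAl -scalemxAr scalerA.
  rewrite -invfM -expr2 sqr_sqrtr ?ltW// [u *m _]mx11_scalar -/c.
  by rewrite scale_scalar_mx mulVf ?gt_eqF.
pose e : 'cV[R]_(1 + n) := col_mx 1%:M 0.
have ee : e^T *m e = 1%:M.
  by rewrite /e tr_col_mx mul_row_col trmx1 mul1mx trmx0 mul0mx addr0.
have [Q [QQ Qe]] := exists_reflection (etrans ee (esym vv)).
have Av : A *m v = a *: v.
  by rewrite /v -scalemxAr -{1}symA -trmx_mul uA linearZ /= !scalerA mulrC.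
pose B : 'M[R]_(1 + n) := Q^T *m A *m Q.
have symB : B^T = B by rewrite /B !trmx_mul trmxK symA mulmxA.
have Be : B *m e = a *: e.
  by rewrite /B -!mulmxA Qe Av -scalemxAr -Qe mulmxA QQ mul1mx.
(* [B e = a e] fixes the first column; symmetry then clears the first row. *)
have BE : B = block_mx a%:M 0 0 (drsubmx B).
  have lB : lsubmx B = a *: e.
    by rewrite -Be -{2}(hsubmxK B) /e mul_row_col mulmx1 mulmx0 addr0.
  move: lB; rewrite -{1}(submxK B) block_mxEh row_mxKl /e scale_col_mx scaler0.
  move=> /eq_col_mx[ul dl].
  rewrite -{1}(submxK B) ul dl scalemx1; congr block_mx.
  by rewrite -(trmxK (ursubmx B)) trmx_ursub symB dl trmx0.
have [F [lam [FF DE]]] : exists (E : 'M[R]_n) (lam : 'rV[R]_n),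
    E^T *m E = 1%:M /\ drsubmx B = E *m diag_mx lam *m E^T.
  by apply: IHn; rewrite trmx_drsub symB.
exists (Q *m block_mx 1%:M 0 0 F), (row_mx a%:M lam).
split.
  rewrite trmx_mul -!mulmxA (mulmxA Q^T) QQ mul1mx.
  rewrite tr_block_mx mulmx_block.
  rewrite !(trmx1, trmx0, mul0mx, mulmx0, mul1mx, addr0, add0r) FF.
  by rewrite -scalar_mx_block.
have QQ' : Q *m Q^T = 1%:M by apply: mulmx1C.
have -> : A = Q *m B *m Q^T.
  by rewrite /B !mulmxA QQ' mul1mx -mulmxA QQ' mulmx1.
rewrite BE diag_mx_row trmx_mul !mulmxA; congr (_ *m _).
rewrite -!mulmxA; congr (_ *m _); rewrite tr_block_mx !mulmx_block.
rewrite !(trmx1, trmx0, mul0mx, mulmx0, mul1mx, mulmx1, addr0, add0r).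
rewrite DE mulmxA; congr block_mx.
by apply/matrixP => i j; rewrite !mxE !ord1 eqxx.
Qed.

(** * Mean value inequality and Taylor estimates *)

Lemma is_derive_scalel (R : realType) (V : normedModType R) (k : R -> R^o)
    (v : V) (x dk : R) :
  is_derive x 1 k dk -> is_derive x 1 (fun t => k t *: v) (dk *: v).
Proof.
move=> [dkx dkE]; have dk' : differentiable k x by apply/derivable1_diffP.
have dkv := differentiableZl v dk'.
apply: DeriveDef; first exact: diff_derivable.
by rewrite deriveE// diffZl// -deriveE// dkE.
Qed.

Section MeanValueInequality.
Variables (R : realType) (V : normedModType R).
Implicit Types f : R -> V.

(* A point t < b is followed by points where |f - z| - M id is smaller, so its
   minimum over [a, b] is attained at b. *)
Lemma norm_growth_le f (z : V) (a b M : R) :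
  a <= b -> {within `[a, b], continuous f} ->
  (forall t, a <= t < b -> derivable f t 1) ->
  (forall t, a <= t < b -> `|'D_1 f t| < M) ->
  `|f b - z| - M * b <= `|f a - z| - M * a.
Proof.
move=> ab cf df fM; pose h t := `|f t - z| - M * t.
have ch : {within `[a, b], continuous h}.
  move=> t; apply: cvgB.
    by apply: cvg_norm; apply: cvgB; [exact: cf | exact: cvg_cst].
  apply: continuous_subspaceT; exact: mulrl_continuous.
have [c cab hc] := EVT_min ab ch.
move: (cab); rewrite in_itv/= => /andP[ac cb].
have [cltb|bc] := ltP c b; last first.
  have -> : b = c by apply/eqP; rewrite eq_le bc cb.
  by apply: hc; rewrite in_itv/= lexx.
exfalso; have acb : a <= c < b by rewrite ac.
have /cvgr_norm_lt/(_ _ (fM c acb)) := df c acb.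
move=> [e /= e0 He]; pose x := Num.min e (b - c) / 2.
have m0 : 0 < Num.min e (b - c) by rewrite lt_min e0 subr_gt0.
have x0 : 0 < x by rewrite divr_gt0.
have [xe xb] : x < e /\ x <= b - c.
  have me : Num.min e (b - c) <= e by rewrite ge_min lexx.
  have mb : Num.min e (b - c) <= b - c by rewrite ge_min lexx orbT.
  by rewrite /x; split; lra.
have /= := He x; rewrite sub0r normrN gtr0_norm// => /(_ xe (lt0r_neq0 x0)).
rewrite normrZ normfV gtr0_norm// ltr_pdivrMl// => fx.
have := hc (c + x); rewrite in_itv/= /h.
have -> : a <= c + x <= b by apply/andP; split; lra.
move=> /(_ isT); apply/negP; rewrite -ltNge.
have := ler_distD (f c) (f (c + x)) z.
move: fx; rewrite /= [x%:A]mulr1 (addrC x c); lra.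
Qed.

(** [norm_growth_le] wants a derivative at the left end and a strict bound. Both are reached in the
    limit: the start moves to some [c > a] while the reference value stays [f a], and the slope is
    raised by [e / (b - c)], which costs [e] in total; then [c] tends to [a]. *)
Lemma mean_value_inequality f (a b M : R) : a <= b ->
  {within `[a, b], continuous f} ->
  (forall t, a < t < b -> derivable f t 1) ->
  (forall t, a < t < b -> `|'D_1 f t| <= M) ->
  `|f b - f a| <= M * (b - a).
Proof.
rewrite le_eqVlt => /predU1P[->|ab] cf df fM.
  by rewrite !subrr normr0 mulr0.
have M0 : 0 <= M.
  have := fM ((a + b) / 2); rewrite !midf_lt// => /(_ isT).
  exact/le_trans/normr_ge0.
have key c : a < c < b -> `|f b - f a| <= `|f c - f a| + M * (b - c).
  move=> /andP[ac cb]; apply/ler_addgt0Pr => e e0.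
  have d0 : 0 < e / (b - c) by rewrite divr_gt0 ?subr_gt0.
  have := @norm_growth_le f (f a) c b (M + e / (b - c)) (ltW cb).
  have cc : {within `[c, b], continuous f}.
    apply: continuous_subspaceW cf; apply: subset_itvr; by rewrite bnd_simp ltW.
  have ce : e = e / (b - c) * (b - c) by rewrite divfK// gt_eqF// subr_gt0.
  move=> /(_ cc); have H : forall t, c <= t < b -> a < t < b.
    by move=> t /andP[ct ->]; rewrite (lt_le_trans ac ct).
  move=> /(_ (fun t ht => df t (H t ht))) F.
  have {}F := F (fun t ht =>
    le_lt_trans (fM t (H t ht)) (ltr_pwDr d0 (lexx _))).
  rewrite [in leRHS]ce; nra.
apply/ler_addgt0Pr => e e0.
have [_ + _] := (continuous_within_itvP f ab).1 cf.
move=> /cvgrPdist_lt/(_ _ e0) fa.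
near a^'+ => c.
have ac : a < c by near: c; exact: nbhs_right_gt.
have cb : c < b by near: c; exact: nbhs_right_lt.
have : `|f a - f c| < e by near: c.
rewrite distrC => fc; have := key c; rewrite ac cb => /(_ isT) {}key.
apply: (le_trans key); rewrite [leRHS]addrC; apply: lerD; first exact: ltW.
by rewrite ler_wpM2l// lerB// ltW.
Unshelve. all: by end_near.
Qed.

End MeanValueInequality.

(** The midpoint lies strictly inside []0, T[], where derivatives exist; the two ends of the step
    are only known to lie in the closed interval. *)
Lemma time_step (R : realFieldType) (T dt : R) (n : nat) :
  0 < dt -> n.+1%:R * dt <= T ->
  [/\ 0 < (n%:R + 2^-1) * dt < T, 0 <= n%:R * dt <= T, 0 <= n.+1%:R * dt <= T,
      n%:R * dt - (n%:R + 2^-1) * dt = - (dt / 2) &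
      n.+1%:R * dt - (n%:R + 2^-1) * dt = dt / 2].
Proof.
move=> dt0; rewrite -natr1 => ndt.
have n0 : 0 <= n%:R * dt by rewrite mulr_ge0 ?ler0n ?ltW.
by split; try field; lra.
Qed.

Section Taylor.
Variables (R : realType) (V : normedModType R) (T : R).
Implicit Types f : R -> V.

(** The bound is required only on the window []a, b[], because the derivative of a Taylor remainder
    is small only near the expansion point. *)
Lemma mean_value_inequality_oi f (M a b s t : R) :
  (forall x, 0 < x < T -> derivable f x 1) ->
  (forall x, 0 < x < T -> a < x < b -> `|'D_1 f x| <= M) ->
  0 < s < T -> 0 < t < T -> a < s < b -> a < t < b ->
  `|f t - f s| <= M * `|t - s|.
Proof.
move=> df fM.
wlog st : s t / s <= t => [H|].
  by case: (leP s t) => [|/ltW] st *; [|rewrite distrC (distrC t)]; exact: H.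
move=> /andP[s0 sT] /andP[t0 tT] /andP[as_ sb] /andP[a_t tb].
rewrite (ger0_norm (_ : 0 <= t - s)) ?subr_ge0//.
apply: mean_value_inequality => // [|x /andP[? ?]|x /andP[? ?]]; last 2 first.
- by apply: df; lra.
- by apply: fM; lra.
apply: derivable_within_continuous => x; rewrite in_itv/= => /andP[sx xt].
by apply: df; lra.
Qed.

Lemma mean_value_inequality_oo f (M s t : R) :
  (forall x, 0 < x < T -> derivable f x 1) ->
  (forall x, 0 < x < T -> `|'D_1 f x| <= M) ->
  0 < s < T -> 0 < t < T -> `|f t - f s| <= M * `|t - s|.
Proof.
move=> df fM sT tT; apply: (@mean_value_inequality_oi f M 0 T) => // x xT _.
exact: fM.
Qed.

Lemma mean_value_inequality_cc f (M a b s t : R) :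
  {within `[0, T], continuous f} ->
  (forall x, 0 < x < T -> derivable f x 1) ->
  (forall x, 0 < x < T -> a < x < b -> `|'D_1 f x| <= M) ->
  0 <= s <= T -> 0 <= t <= T -> a <= s <= b -> a <= t <= b ->
  `|f t - f s| <= M * `|t - s|.
Proof.
move=> cf df fM.
wlog st : s t / s <= t => [H|].
  by case: (leP s t) => [|/ltW] st *; [|rewrite distrC (distrC t)]; exact: H.
move=> /andP[s0 sT] /andP[t0 tT] /andP[as_ sb] /andP[a_t tb].
rewrite (ger0_norm (_ : 0 <= t - s)) ?subr_ge0//.
apply: mean_value_inequality => // [|x /andP[sx xt]|x /andP[sx xt]].
- by apply: continuous_subspaceW cf; apply: subset_itvScc; rewrite bnd_simp.
- by apply: df; lra.
- by apply: fM; lra.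
Qed.

Lemma smooth_in_time_bounded p f : smooth_in_time p T f ->
  exists2 M : R, 0 <= M & forall t, 0 < t < T -> `|derive1n p f t| <= M.
Proof.
move=> [_ _ [M fM]]; exists `|M| => // t /fM/le_trans; apply; exact: ler_norm.
Qed.

(** The bound on the lower derivative is propagated from [T / 2], a point where that derivative
    certainly exists; at [0] and [T] nothing is known about it. *)
Lemma smooth_in_time_pred p f : smooth_in_time p.+1 T f -> smooth_in_time p T f.
Proof.
move=> sf; have [M M0 fM] := smooth_in_time_bounded sf.
case: sf => cf df _; split => // [j t jp|]; first exact/df/ltnW.
have [T0|T0] := ltP 0 T; last by exists 0 => t; lra.
exists (`|derive1n p f (T / 2)| + M * T) => t tT.
have hT : 0 < T / 2 < T by lra.
have := @mean_value_inequality_oo (derive1n p f) M (T / 2) t.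
have d x : 0 < x < T -> derivable (derive1n p f) x 1 by exact: df.
have dM x : 0 < x < T -> `|'D_1 (derive1n p f) x| <= M.
  by rewrite -derive1E -derive1nS; exact: fM.
move=> /(_ d dM hT tT) le1.
have := ler_normD (derive1n p f (T / 2))
  (derive1n p f t - derive1n p f (T / 2)).
rewrite addrC subrK => /le_trans; apply; rewrite lerD2l (le_trans le1)//.
rewrite ler_wpM2l// ler_norml; lra.
Qed.

Let derive_taylor1 (c : R) (v : V) (x : R) :
  is_derive x (1 : R) (fun t : R => (t - c) *: v) v.
Proof.
rewrite -[v in is_derive _ _ _ v]scale1r; apply: is_derive_scalel.
by apply: is_derive_eq; rewrite subr0.
Qed.

Let derive_taylor2 (c : R) (v : V) (x : R) :
  is_derive x (1 : R) (fun t : R => ((t - c) ^+ 2 / 2) *: v) ((x - c) *: v).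
Proof.
apply: is_derive_scalel.
have -> : (fun t : R => (t - c) ^+ 2 / 2 : R^o) =
    2^-1 \*: ((id - cst c : R -> R) ^+ 2).
  by apply/funext => t; rewrite mulrC.
apply: is_derive_eq.
rewrite /= subr0 [_ *: 1]mulr1 /GRing.scale /=.
by rewrite -[(id - cst c) x]/(x - c); field.
Qed.

Let is_derive_continuous (g dg : R -> V) :
  (forall x : R, is_derive x (1 : R) g (dg x)) -> continuous g.
Proof.
move=> dgE x; apply/differentiable_continuous/derivable1_diffP.
by case: (dgE x).
Qed.

Let within_continuousB (A : set R) (f g : R -> V) :
  {within A, continuous f} -> continuous g ->
  {within A, continuous (fun x => f x - g x)}.
Proof.
move=> cf cg x; apply: cvgB; first exact: cf.
by have /(_ x) := @continuous_subspaceT _ _ A _ cg.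
Qed.

(** The remainder [P] has derivative [f' x - f' c], of norm at most [M |t - c|] on the window of
    radius [|t - c|] about [c]. As nothing is integrated, the constant is [M] instead of [M / 2]. *)
Lemma smooth_in_time_taylor1 f : smooth_in_time 2 T f ->
  exists2 M : R, 0 <= M & forall c t, 0 < c < T -> 0 <= t <= T ->
    `|f t - f c - (t - c) *: derive1 f c| <= M * `|t - c| ^+ 2.
Proof.
move=> sf; have [M M0 fM] := smooth_in_time_bounded sf.
exists M => // c t cT tT.
have [cf df _] := sf.
pose P x := f x - (x - c) *: derive1 f c.
have dP x : 0 < x < T -> is_derive x 1 P (derive1 f x - derive1 f c).
  move=> xT; apply: is_deriveB; last exact: derive_taylor1.
  by rewrite derive1E; apply: derivableP; exact: (df 0%N).
have cP : {within `[0, T], continuous P}.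
  apply: within_continuousB => //.
  exact: (is_derive_continuous (derive_taylor1 _ _)).
have -> : f t - f c - (t - c) *: derive1 f c = P t - P c.
  by rewrite /P subrr scale0r subr0 addrAC.
have PM x : 0 < x < T -> c - `|t - c| < x < c + `|t - c| ->
    `|'D_1 P x| <= M * `|t - c|.
  move=> xT xc; rewrite (@derive_val _ _ _ _ _ _ _ (dP x xT)).
  have := @mean_value_inequality_oo (derive1n 1 f) M c x (df 1%N ^~ isT).
  move=> /(_ _ cT xT)/le_trans; apply.
    by move=> y; rewrite -derive1E -derive1nS; exact: fM.
  by rewrite ler_wpM2l// ler_norml; lra.
have := @mean_value_inequality_cc P (M * `|t - c|)
  (c - `|t - c|) (c + `|t - c|) c t.
move=> /(_ cP) /(_ _ PM); rewrite -mulrA -expr2; apply => //.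
- by move=> x /dP[].
- by move: cT => /andP[? ?]; rewrite !ltW.
- by have := normr_ge0 (t - c); lra.
- by have := ler_norm (t - c); have := ler_norm (c - t); rewrite distrC; lra.
Qed.

(** Two nested uses of the mean value inequality: the derivative of [P] is [Q x - Q c], where [Q] is
    [f'] minus the linear term of its expansion at [c], and the derivative of [Q] is at most
    [M |t - c|] on the window. *)
Lemma smooth_in_time_taylor2 f : smooth_in_time 3 T f ->
  exists2 M : R, 0 <= M & forall c t, 0 < c < T -> 0 <= t <= T ->
    `|f t - f c - (t - c) *: derive1 f c
      - ((t - c) ^+ 2 / 2) *: derive1 (derive1 f) c| <= M * `|t - c| ^+ 3.
Proof.
move=> sf; have [M M0 fM] := smooth_in_time_bounded sf.
exists M => // c t cT tT.
have [cf df _] := sf.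
pose P x := f x - (x - c) *: derive1 f c
  - ((x - c) ^+ 2 / 2) *: derive1 (derive1 f) c.
pose Q x := derive1 f x - (x - c) *: derive1 (derive1 f) c.
have dP x : 0 < x < T -> is_derive x 1 P
    (derive1 f x - derive1 f c - (x - c) *: derive1 (derive1 f) c).
  move=> xT; apply: is_deriveB; last exact: derive_taylor2.
  apply: is_deriveB; last exact: derive_taylor1.
  by rewrite derive1E; apply: derivableP; exact: (df 0%N).
have dQ x : 0 < x < T -> is_derive x 1 Q
    (derive1 (derive1 f) x - derive1 (derive1 f) c).
  move=> xT; apply: is_deriveB; last exact: derive_taylor1.
  by rewrite (derive1E (derive1 f) x); apply: derivableP; exact: (df 1%N).
have cP : {within `[0, T], continuous P}.
  apply: within_continuousB; last first.
    exact: (is_derive_continuous (derive_taylor2 _ _)).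
  apply: within_continuousB => //.
  exact: (is_derive_continuous (derive_taylor1 _ _)).
have -> : f t - f c - (t - c) *: derive1 f c
    - ((t - c) ^+ 2 / 2) *: derive1 (derive1 f) c = P t - P c.
  rewrite /P subrr expr0n mul0r !scale0r !subr0.
  by rewrite [RHS]addrAC; congr (_ - _); rewrite addrAC.
have QM x : 0 < x < T -> c - `|t - c| < x < c + `|t - c| ->
    `|Q x - Q c| <= M * `|t - c| * `|x - c|.
  move=> xT xc; have QM' y : 0 < y < T -> c - `|t - c| < y < c + `|t - c| ->
      `|'D_1 Q y| <= M * `|t - c|.
    move=> yT yc; rewrite (@derive_val _ _ _ _ _ _ _ (dQ y yT)).
    have := @mean_value_inequality_oo (derive1n 2 f) M c y (df 2%N ^~ isT).
    move=> /(_ _ cT yT)/le_trans; apply.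
      by move=> z; rewrite -derive1E -derive1nS; exact: fM.
    by rewrite ler_wpM2l// ler_norml; lra.
  have := @mean_value_inequality_oi Q (M * `|t - c|) (c - `|t - c|)
    (c + `|t - c|) c x.
  by apply => // [y /dQ[]//|]; lra.
have PM x : 0 < x < T -> c - `|t - c| < x < c + `|t - c| ->
    `|'D_1 P x| <= M * `|t - c| ^+ 2.
  move=> xT xc; rewrite (@derive_val _ _ _ _ _ _ _ (dP x xT)).
  have -> : derive1 f x - derive1 f c - (x - c) *: derive1 (derive1 f) c =
      Q x - Q c.
    by rewrite /Q subrr scale0r subr0 addrAC.
  rewrite (le_trans (QM x xT xc))// expr2 mulrA ler_wpM2l ?mulr_ge0//.
  by rewrite ler_norml; lra.
have := @mean_value_inequality_cc P (M * `|t - c| ^+ 2)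
  (c - `|t - c|) (c + `|t - c|) c t.
move=> /(_ cP) /(_ _ PM); rewrite -mulrA -exprSr; apply => //.
- by move=> x /dP[].
- by move: cT => /andP[? ?]; rewrite !ltW.
- by have := normr_ge0 (t - c); lra.
- by have := ler_norm (t - c); have := ler_norm (c - t); rewrite distrC; lra.
Qed.
(** The first-order terms at distance [dt / 2] on either side of the midpoint have opposite signs
    and cancel in the sum. *)
Lemma midpoint_average f : 0 < T -> smooth_in_time 2 T f ->
  exists2 M : R, 0 <= M & forall dt n, 0 < dt -> n.+1%:R * dt <= T ->
    `|f (n.+1%:R * dt) + f (n%:R * dt) - 2 *: f ((n%:R + 2^-1) * dt)|
      <= M * dt ^+ 2.
Proof.
move=> T0 /smooth_in_time_taylor1[M M0 fM]; exists M => // dt n dt0 ndt.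
have [cT aT bT Ea Eb] := time_step dt0 ndt.
have := lerD (fM _ _ cT bT) (fM _ _ cT aT); rewrite Ea Eb.
rewrite normrN (ger0_norm (_ : 0 <= dt / 2)); last by rewrite divr_ge0 ?ltW.
move=> /(le_trans (ler_normD _ _)).
rewrite addrACA -opprD -scalerDl addrN scale0r subr0.
rewrite addrACA -opprD -mulr2n -[_ *+ 2]scaler_nat => /le_trans; apply.
by rewrite expr_div_n; have := sqr_ge0 dt; nra.
Qed.

(** In the difference of the two expansions the quadratic terms cancel, leaving a cubic error;
    division by [dt] makes it quadratic. *)
Lemma central_difference f : smooth_in_time 3 T f ->
  exists2 M : R, 0 <= M & forall dt n, 0 < dt -> n.+1%:R * dt <= T ->
    `|dt^-1 *: (f (n.+1%:R * dt) - f (n%:R * dt))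
       - derive1 f ((n%:R + 2^-1) * dt)| <= M * dt ^+ 2.
Proof.
move=> /smooth_in_time_taylor2[M M0 fM]; exists M => // dt n dt0 ndt.
have [cT aT bT Ea Eb] := time_step dt0 ndt.
set c := (_ + _) * dt in cT Ea Eb *.
have := lerD (fM _ _ cT bT) (fM _ _ cT aT); rewrite Ea Eb.
rewrite normrN (ger0_norm (_ : 0 <= dt / 2)); last by rewrite divr_ge0 ?ltW.
move=> /(le_trans (ler_normB _ _)).
have -> : f (n.+1%:R * dt) - f c - (dt / 2) *: derive1 f c
    - ((dt / 2) ^+ 2 / 2) *: derive1 (derive1 f) c
    - (f (n%:R * dt) - f c - (- (dt / 2)) *: derive1 f c
    - ((- (dt / 2)) ^+ 2 / 2) *: derive1 (derive1 f) c)
  = dt *: (dt^-1 *: (f (n.+1%:R * dt) - f (n%:R * dt)) - derive1 f c).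
  rewrite sqrrN scalerBr scalerA divff ?gt_eqF// scale1r.
  have -> : dt *: derive1 f c =
      (dt / 2) *: derive1 f c + (dt / 2) *: derive1 f c.
    by rewrite -scalerDl -splitr.
  rewrite scaleNr opprK opprB addrA subrK opprD opprB -[_ - f c - _]addrAC.
  by rewrite 2!addrA subrK [_ - _ - f _]addrAC opprD addrA.
rewrite normrZ gtr0_norm// -ler_pdivlMl// => /le_trans; apply.
rewrite -mulrDr mulrCA ler_wpM2l// ler_pdivrMl//.
rewrite -exprS expr_div_n; have : 0 <= dt ^+ 3 by rewrite exprn_ge0 ?ltW.
lra.
Qed.

Lemma smooth_in_time_bound f : 0 < T -> smooth_in_time 1 T f ->
  exists2 M : R, 0 <= M & forall t, 0 <= t <= T -> `|f t| <= M.
Proof.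
move=> T0 sf; have [M M0 fM] := smooth_in_time_bounded sf.
have [cf df _] := sf; exists (`|f 0| + M * T) => [|t /andP[t0 tT]].
  by rewrite addr_ge0// mulr_ge0// ltW.
rewrite -[f t](subrK (f 0)) addrC (le_trans (ler_normD _ _))// lerD2l.
have f'M x : 0 < x < T -> 0 < x < T -> `|'D_1 f x| <= M.
  by move=> xT _; rewrite -derive1E; exact: fM.
have := @mean_value_inequality_cc f M 0 T 0 t cf (df 0%N ^~ isT) f'M.
rewrite subr0 ger0_norm// lexx t0 tT ltW// => /(_ isT isT isT isT) le1.
rewrite (le_trans le1)//.
by rewrite ler_wpM2l.
Qed.

End Taylor.

(** * The L^2 inner product *)

Section InnerProduct.
Variables (R : realType) (m : nat) (Omega : set 'rV[R]_m).
Variables (nu : {measure set (borel_rV R m) -> \bar R}).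
Variables (V : normedModType R) (ev : V -> 'rV[R]_m -> R).
Hypotheses (oOmega : open Omega) (hV : function_space Omega nu ev).
Local Notation ip := (inner Omega nu ev).
Local Notation nrm := (L2norm Omega nu ev).

Let mOmega : measurable (Omega : set (borel_rV R m)).
Proof. exact: sub_sigma_algebra. Qed.

(** From [|f g| <= f^2 + g^2]. The bilinearity of [inner] rests on this, since integrals may be
    added only for integrable functions. *)
Lemma integrable_ev_mul f g :
  nu.-integrable Omega (fun x => (ev f x * ev g x)%:E).
Proof.
have [_ _ mev sqev _] := hV.
apply: (le_integrable mOmega _ _ (integrableD mOmega (sqev f) (sqev g))).
  apply/measurable_EFinP/measurable_funM; exact: mev.
move=> x Ox /=; rewrite lee_fin [leRHS]ger0_norm ?addr_ge0 ?sqr_ge0//.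
rewrite ler_norml.
by have := sqr_ge0 (ev f x + ev g x); have := sqr_ge0 (ev f x - ev g x); nra.
Qed.

Lemma inner_linearl a f g h : ip (a *: f + g) h = a * ip f h + ip g h.
Proof.
have [lev _ _ _ _] := hV.
rewrite /inner -RintegralZl//; last exact: integrable_ev_mul.
rewrite -RintegralD//; last 2 first.
- exact: integrableZl (integrable_ev_mul _ _).
- exact: integrable_ev_mul.
by apply: eq_Rintegral => x /[!inE] Ox; rewrite lev// mulrDl mulrA.
Qed.

Lemma innerC f g : ip f g = ip g f.
Proof. by apply: eq_Rintegral => x _; rewrite mulrC. Qed.

Lemma innerDl f g h : ip (f + g) h = ip f h + ip g h.
Proof. by rewrite -[f]scale1r inner_linearl mul1r scale1r. Qed.

Lemma inner0l h : ip 0 h = 0.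
Proof. by apply: (addrI (ip 0 h)); rewrite -innerDl !addr0. Qed.

Lemma innerZl a f h : ip (a *: f) h = a * ip f h.
Proof. by rewrite -[a *: f]addr0 inner_linearl inner0l addr0. Qed.

Lemma innerDr f g h : ip h (f + g) = ip h f + ip h g.
Proof. by rewrite !(innerC h) innerDl. Qed.

Lemma innerZr a f h : ip h (a *: f) = a * ip h f.
Proof. by rewrite !(innerC h) innerZl. Qed.

Lemma innerNl f h : ip (- f) h = - ip f h.
Proof. by rewrite -scaleN1r innerZl mulN1r. Qed.

Lemma innerNr f h : ip h (- f) = - ip h f.
Proof. by rewrite !(innerC h) innerNl. Qed.

Lemma innerBl f g h : ip (f - g) h = ip f h - ip g h.
Proof. by rewrite innerDl innerNl. Qed.

Lemma innerBr f g h : ip h (f - g) = ip h f - ip h g.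
Proof. by rewrite innerDr innerNr. Qed.

Lemma inner_suml (I : Type) (s : seq I) (F : I -> V) h :
  ip (\sum_(i <- s) F i) h = \sum_(i <- s) ip (F i) h.
Proof.
elim/big_ind2 : _ => [|x u y v <- <-|//]; [exact: inner0l | exact: innerDl].
Qed.

Lemma inner_sumr (I : Type) (s : seq I) (F : I -> V) h :
  ip h (\sum_(i <- s) F i) = \sum_(i <- s) ip h (F i).
Proof. by rewrite innerC inner_suml; apply: eq_bigr => i _; exact: innerC. Qed.

Lemma inner_sumE k (u v : 'I_k -> V) :
  inner_sum Omega nu ev u v = \sum_(j < k) ip (u j) (v j).
Proof.
rewrite /inner_sum; elim: (index_enum _) => [|i s IHs].
  rewrite big_nil /Rintegral (eq_integral (cst 0%E)) ?integral0//.
  by move=> x _; rewrite big_nil.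
rewrite big_cons -IHs /inner -RintegralD//; last 2 first.
- exact: integrable_ev_mul.
- elim: s {IHs} => [|j s IHs].
    apply: eq_integrable (integrable0 _ _) => // x _; by rewrite /= big_nil.
  apply: eq_integrable (integrableD mOmega (integrable_ev_mul _ _) IHs) => //.
  by move=> x _; rewrite /= big_cons.
by apply: eq_Rintegral => x _; rewrite big_cons.
Qed.

Lemma inner_ge0 f : 0 <= ip f f.
Proof. by apply: Rintegral_ge0 => x _; rewrite -expr2 sqr_ge0. Qed.

Lemma L2norm_ge0 f : 0 <= nrm f. Proof. exact: sqrtr_ge0. Qed.

Lemma sqr_L2norm f : nrm f ^+ 2 = ip f f.
Proof. by rewrite sqr_sqrtr// inner_ge0. Qed.

Lemma Cauchy_Schwarz f g : `|ip f g| <= nrm f * nrm g.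
Proof.
rewrite -(ler_pXn2r (_ : 0 < 2)%N) ?nnegrE ?mulr_ge0 ?L2norm_ge0//.
rewrite exprMn !sqr_L2norm real_normK ?num_real//.
have H t : 0 <= ip f f + 2 * t * ip f g + t ^+ 2 * ip g g.
  have := inner_ge0 (f + t *: g).
  rewrite innerDl !innerDr !innerZl !innerZr (innerC g f).
  by congr (_ <= _); ring.
have := inner_ge0 g; rewrite le_eqVlt => /predU1P[g0|g0].
  (* A [g] vanishing almost everywhere is not known to be [0], so this case needs an argument: the
     quadratic is affine in [t], and unless [ip f g = 0] this [t] makes it equal to
     [- ip f f - 2 < 0]. *)
  rewrite -g0 mulr0. have := H (- (ip f f + 1) / ip f g). rewrite -g0.
  have [->|fg0] := eqVneq (ip f g) 0; first by rewrite expr0n.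
  have -> : ip f f + 2 * (- (ip f f + 1) / ip f g) * ip f g +
    (- (ip f f + 1) / ip f g) ^+ 2 * 0 = - ip f f - 2 by field.
  have := inner_ge0 f; lra.
(* The minimizer of the quadratic. *)
have := H (- ip f g / ip g g).
have -> : ip f f + 2 * (- ip f g / ip g g) * ip f g +
   (- ip f g / ip g g) ^+ 2 * ip g g = ip f f - ip f g ^+ 2 / ip g g.
  by field; rewrite gt_eqF.
by rewrite subr_ge0 ler_pdivrMr.
Qed.

Lemma L2normD f g : nrm (f + g) <= nrm f + nrm g.
Proof.
rewrite -(ler_pXn2r (_ : 0 < 2)%N) ?nnegrE ?addr_ge0 ?L2norm_ge0//.
rewrite sqrrD !sqr_L2norm innerDl !innerDr (innerC g f).
have := le_trans (ler_norm _) (Cauchy_Schwarz f g); lra.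
Qed.

Lemma L2normZ a f : nrm (a *: f) = `|a| * nrm f.
Proof.
by rewrite /L2norm innerZl innerZr mulrA -expr2 sqrtrM ?sqr_ge0// sqrtr_sqr.
Qed.

Lemma L2normN f : nrm (- f) = nrm f.
Proof. by rewrite -scaleN1r L2normZ normrN1 mul1r. Qed.

Lemma L2norm0 : nrm 0 = 0.
Proof. by rewrite /L2norm inner0l sqrtr0. Qed.

Lemma L2norm_sum (I : Type) (s : seq I) (F : I -> V) :
  nrm (\sum_(i <- s) F i) <= \sum_(i <- s) nrm (F i).
Proof.
elim/big_ind2 : _ => [|x u y v xu yv|//]; first by rewrite L2norm0.
exact: le_trans (L2normD _ _) (lerD xu yv).
Qed.

Lemma L2norm_dominated : exists2 C : R, 0 <= C & forall f, nrm f <= C * `|f|.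
Proof.
have [_ _ _ _ [C hC]] := hV; exists `|C| => // f.
by rewrite (le_trans (hC f))// ler_wpM2r// ler_norm.
Qed.
End InnerProduct.

(** * Energy law and decoupling *)

Section MatrixAction.
Variables (R : realType) (V : normedModType R) (k : nat).
Implicit Types (E F : 'M[R]_k) (u v : 'I_k -> V).

Lemma mxactM E F u : mxact E (mxact F u) = mxact (E *m F) u.
Proof.
apply/funext => i; rewrite /mxact.
under eq_bigr do rewrite scaler_sumr; rewrite exchange_big /=.
apply: eq_bigr => l _; rewrite mxE scaler_suml.
by apply: eq_bigr => j _; rewrite scalerA.
Qed.

Lemma mxact_diag (l : 'rV[R]_k) u i : mxact (diag_mx l) u i = l 0 i *: u i.
Proof.
rewrite /mxact (bigD1 i)//= big1 ?addr0; first by rewrite mxE eqxx.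
by move=> j ji; rewrite mxE eq_sym (negbTE ji) scale0r.
Qed.

Lemma mxact1 u : mxact 1%:M u = u.
Proof.
by apply/funext => i; rewrite -diag_const_mx mxact_diag mxE scale1r.
Qed.

(** A constant matrix mixes components, an operator acts inside each of them. That the two commute
    is what lets one change of basis decouple the system. *)
Lemma mxact_linear E (H : {linear V -> V}) u i :
  mxact E (fun j => H (u j)) i = H (mxact E u i).
Proof.
by rewrite /mxact linear_sum; apply: eq_bigr => j _; rewrite linearZ.
Qed.

Lemma mxactDZ E (a : R) u v i :
  mxact E (fun j => u j + a *: v j) i = mxact E u i + a *: mxact E v i.
Proof.
rewrite /mxact scaler_sumr -big_split; apply: eq_bigr => j _ /=.
by rewrite scalerDr !scalerA mulrC.
Qed.
End MatrixAction.

Section Coupled.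
Variables (R : realType) (m : nat) (Omega : set 'rV[R]_m).
Variables (nu : {measure set (borel_rV R m) -> \bar R}).
Variables (V : normedModType R) (ev : V -> 'rV[R]_m -> R).
Hypotheses (oOmega : open Omega) (hV : function_space Omega nu ev).
Variables (k : nat) (G L : {linear V -> V}).
Hypotheses (hGneg : nonpositive_op Omega nu ev G)
  (hLpos : nonnegative_op Omega nu ev L).
Hypothesis hsolv : forall (lam : R) (g : V), 0 < lam ->
  exists! psi : V, psi - lam *: G (L psi) = g.
Local Notation ip := (inner Omega nu ev).
Implicit Types (chi psi c : 'I_k -> V).

Lemma inner_mxact (E : 'M[R]_k) (u v : 'I_k -> V) :
  \sum_i ip (mxact E u i) (v i) = \sum_i ip (u i) (mxact E^T v i).
Proof.
under eq_bigr do rewrite (inner_suml oOmega hV).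
under [RHS]eq_bigr do rewrite (inner_sumr oOmega hV).
rewrite exchange_big; apply: eq_bigr => i _; apply: eq_bigr => j _ /=.
by rewrite (innerZl oOmega hV) (innerZr oOmega hV) mxE.
Qed.

(** The operator [I - D G L] on vectors of functions, which [E] conjugates to the diagonal family
    [I - lam i G L]. *)
Definition coupled (D : 'M[R]_k) chi (i : 'I_k) : V :=
  chi i - mxact D (fun j => G (L (chi j))) i.

Variables (D E : 'M[R]_k) (lam : 'I_k -> R).
Hypotheses (diagD : orthogonally_diagonalizes D E lam)
  (lam_gt0 : forall i, 0 < lam i).

Let EtE : E^T *m E = 1%:M. Proof. by case: diagD. Qed.
Let EEt : E *m E^T = 1%:M. Proof. exact: mulmx1C. Qed.

Lemma mxact_diagonalizes psi :
  mxact D (mxact E psi) = mxact E (fun i => lam i *: psi i).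
Proof.
rewrite mxactM (proj2 diagD) -mulmxA EtE mulmx1 -mxactM; congr mxact.
by apply/funext => i; rewrite mxact_diag mxE.
Qed.

Lemma coupled_mxact psi :
  coupled D (mxact E psi) = mxact E (fun i => psi i - lam i *: G (L (psi i))).
Proof.
apply/funext => i; rewrite /coupled.
have -> : (fun j => G (L (mxact E psi j))) = mxact E (fun j => G (L (psi j))).
  by apply/funext => j; rewrite !mxact_linear.
rewrite mxact_diagonalizes.
under [in RHS]eq_fun do rewrite -scaleN1r.
by rewrite mxactDZ scaleN1r.
Qed.

Lemma decoupled_solves psi c :
  (forall i, psi i - lam i *: G (L (psi i)) = mxact E^T c i) ->
  coupled D (mxact E psi) = c.
Proof.
by move=> /funext psiE; rewrite coupled_mxact psiE mxactM EEt mxact1.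
Qed.

(** Applying [E^T] reduces this to uniqueness for each scalar equation; it is needed to show that
    every solution of the scheme has the form built from [psi1] and [psi2]. *)
Lemma coupled_inj chi chi' : coupled D chi = coupled D chi' -> chi = chi'.
Proof.
rewrite -[chi]mxact1 -[chi']mxact1 -EEt -!mxactM !coupled_mxact.
move=> /(congr1 (mxact E^T)) H; move: H.
rewrite ![mxact E^T (mxact E _)]mxactM EtE !mxact1 => H.
congr (mxact E _); apply/funext => i.
have [x [_ xuniq]] := hsolv
  (mxact E^T chi' i - lam i *: G (L (mxact E^T chi' i))) (lam_gt0 i).
have /= Hi := congr1 (@^~ i) H.
by rewrite -(xuniq _ Hi) -(xuniq _ erefl).
Qed.

Lemma coupledDZ (a : R) chi chi' i :
  coupled D (fun j => chi j + a *: chi' j) i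
  = coupled D chi i + a *: coupled D chi' i.
Proof.
rewrite /coupled.
have -> : (fun j => G (L (chi j + a *: chi' j))) =
    (fun j => G (L (chi j)) + a *: G (L (chi' j))).
  by apply/funext => j; rewrite !linearD !linearZ.
by rewrite mxactDZ scalerBr opprD addrACA.
Qed.

(** In the eigenbasis the sum becomes that of [lam i * ip (L (psi i)) (psi i)], where both factors
    are non-negative. *)
Lemma inner_diagonalized_ge0 chi :
  0 <= \sum_i ip (mxact D (fun j => L (chi j)) i) (chi i).
Proof.
rewrite -[chi]mxact1 -EEt -mxactM; set psi := mxact E^T chi.
have -> : (fun j => L (mxact E psi j)) = mxact E (fun j => L (psi j)).
  by apply/funext => j; rewrite mxact_linear.
rewrite mxact_diagonalizes inner_mxact mxactM EtE mxact1 sumr_ge0// => i _.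
rewrite (innerZl oOmega hV) innerC; apply: mulr_ge0 (hLpos _); exact: ltW.
Qed.

(* With w = a b + D L chi, the equation reads chi = G w, so that
   a (b, chi) = (w, G w) - (D L chi, chi) <= 0. *)
Lemma inner_coupled_le0 (a : R) (b chi : 'I_k -> V) : 0 < a ->
  coupled D chi = (fun i => a *: G (b i)) -> \sum_i ip (b i) (chi i) <= 0.
Proof.
move=> a0 /funeqP chiE; pose w i := mxact D (fun j => L (chi j)) i + a *: b i.
have Gw i : G (w i) = chi i.
  rewrite linearD linearZ /= -mxact_linear -chiE /coupled addrC subrK//.
rewrite -(pmulr_rle0 _ a0) mulr_sumr.
have -> : \sum_i a * ip (b i) (chi i) = \sum_i ip (w i) (G (w i))
    - \sum_i ip (mxact D (fun j => L (chi j)) i) (chi i).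
  rewrite -sumrB; apply: eq_bigr => i _.
  by rewrite Gw (innerDl oOmega hV) (innerZl oOmega hV) addrAC subrr add0r.
rewrite subr_le0 (le_trans _ (inner_diagonalized_ge0 chi))//.
by apply: sumr_le0 => i _; exact: hGneg.
Qed.

End Coupled.

Section Scheme.
Variables (R : realType) (m : nat) (Omega : set 'rV[R]_m).
Variables (nu : {measure set (borel_rV R m) -> \bar R}).
Variables (V : normedModType R) (ev : V -> 'rV[R]_m -> R).
Hypotheses (oOmega : open Omega) (hV : function_space Omega nu ev).
Variables (k : nat) (G L : {linear V -> V}) (d : 'M[R]_k).
Hypotheses (hGneg : nonpositive_op Omega nu ev G)
  (hLsym : symmetric_op Omega nu ev L) (hLpos : nonnegative_op Omega nu ev L)
  (hdsym : d^T = d).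
Variables (E1 : ('I_k -> V) -> R) (U : 'I_k -> ('I_k -> V) -> V).
Local Notation ip := (inner Omega nu ev).
Implicit Types (phi mu phib : 'I_k -> V).

Let Q phi (phi' : 'I_k -> V) := \sum_i \sum_j d i j * ip (L (phi j)) (phi' i).

Let QC phi (phi' : 'I_k -> V) : Q phi phi' = Q phi' phi.
Proof.
rewrite /Q exchange_big; apply: eq_bigr => i _; apply: eq_bigr => j _ /=.
by rewrite hLsym innerC -[in LHS]hdsym mxE.
Qed.

Lemma sav_cn_energy dt phib phi r phi' mu r' : 0 < dt ->
  sav_cn Omega nu ev G L d E1 U dt phib phi r phi' mu r' ->
  dt^-1 * sav_energy Omega nu ev L d phi' r'
    - dt^-1 * sav_energy Omega nu ev L d phi r
  = \sum_(i < k) ip (G (mu i)) (mu i).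
Proof.
move=> dt0 [phiE muE]; rewrite (inner_sumE oOmega hV) => rE.
rewrite -mulrBr /sav_energy -/(Q phi phi) -/(Q phi' phi').
under [RHS]eq_bigr => i _ do rewrite -phiE (innerZl oOmega hV).
rewrite -mulr_sumr; congr (_ * _).
set b := half_b E1 U phib in muE rE.
(* By the third equation of the scheme, pairing [b] with the increment of [phi] gives [r' - r]; the
   nonlinear part thus contributes exactly [r'^2 - r^2]. *)
have -> : \sum_i ip (phi' i - phi i) (mu i) =
    2^-1 * (Q (fun i => phi' i + phi i) (fun i => phi' i - phi i))
    + (r' + r) * (r' - r).
  rewrite rE /Q !mulr_sumr -big_split; apply: eq_bigr => i _ /=.
  rewrite muE [LHS](innerDr oOmega hV).
  rewrite 2!(innerZr oOmega hV _ _ (phi' i - phi i)).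
  rewrite (innerC _ _ _ (b i)) (inner_sumr oOmega hV).
  congr (_ * _ + _); apply: eq_bigr => j _.
  by rewrite (innerZr oOmega hV) innerC.
have -> : Q (fun i => phi' i + phi i) (fun i => phi' i - phi i) =
    Q phi' phi' + Q phi phi' - (Q phi' phi + Q phi phi).
  rewrite /Q -!big_split -sumrB; apply: eq_bigr => i _ /=.
  rewrite -!big_split -sumrB; apply: eq_bigr => j _ /=.
  rewrite linearD (innerDl oOmega hV) !(innerBr oOmega hV); ring.
by rewrite (QC phi' phi); ring.
Qed.

Lemma inner_G_sum_le0 mu : \sum_(i < k) ip (G (mu i)) (mu i) <= 0.
Proof. by apply: sumr_le0 => i _; rewrite innerC; exact: hGneg. Qed.

(** The elimination of [mu] and [r'] as an equivalence. The unknown [phi'] survives on the right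
    only through one scalar, its pairing with [b]. *)
Lemma sav_cn_coupled dt phib phi r phi' mu r' : 0 < dt ->
  let b := half_b E1 U phib in
  sav_cn Omega nu ev G L d E1 U dt phib phi r phi' mu r' <->
  [/\ coupled G L ((dt / 2) *: d) phi' = (fun i =>
        phi i + \sum_(j < k) (dt / 2 * d i j) *: G (L (phi j))
        + (dt * (2 * r - \sum_(j < k) ip (b j) (phi j))) *: G (b i)
        + (\sum_(j < k) ip (b j) (phi' j)) *: (dt *: G (b i))),
      r' = r + inner_sum Omega nu ev b (fun j => phi' j - phi j) &
      forall i, mu i = 2^-1 *: \sum_(j < k) d i j *: L (phi' j + phi j)
               + (r' + r) *: b i].
Proof.
move=> dt0 b; rewrite /sav_cn -/b; clearbody b.
have rE : (r' - r = inner_sum Omega nu ev b (fun j => phi' j - phi j)) <->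
    (r' = r + inner_sum Omega nu ev b (fun j => phi' j - phi j)).
  by split => [<-|->]; [rewrite addrC subrK | rewrite addrC addKr].
have key : (forall i, mu i = 2^-1 *: \sum_(j < k) d i j *: L (phi' j + phi j)
               + (r' + r) *: b i) ->
    r' = r + inner_sum Omega nu ev b (fun j => phi' j - phi j) ->
    forall i, (dt^-1 *: (phi' i - phi i) = G (mu i)) <->
    (coupled G L ((dt / 2) *: d) phi' i =
        phi i + \sum_(j < k) (dt / 2 * d i j) *: G (L (phi j))
        + (dt * (2 * r - \sum_(j < k) ip (b j) (phi j))) *: G (b i)
        + (\sum_(j < k) ip (b j) (phi' j)) *: (dt *: G (b i))).
  move=> muE r'E i.
  have GmuE : dt *: G (mu i) =
      mxact ((dt / 2) *: d) (fun j => G (L (phi' j))) i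
      + \sum_(j < k) (dt / 2 * d i j) *: G (L (phi j))
      + ((dt * (2 * r - \sum_(j < k) ip (b j) (phi j))) *: G (b i)
        + (\sum_(j < k) ip (b j) (phi' j)) *: (dt *: G (b i))).
    rewrite muE linearD !linearZ /= linear_sum scalerDr !scalerA scaler_sumr.
    congr (_ + _).
      rewrite -big_split; apply: eq_bigr => j _ /=.
      rewrite mxE [G (_ *: _)]linearZ [L (_ + _)]linearD.
      by rewrite [G (_ + _)]linearD /= scalerA scalerDr.
    (* Here [r' + r = 2 r - (b, phi) + (b, phi')]: the known part goes into the data, the last term
       is the scalar unknown. *)
    rewrite -scalerDl; congr (_ *: _); rewrite r'E (inner_sumE oOmega hV).
    under [X in r + X + r]eq_bigr do rewrite (innerBr oOmega hV).
    rewrite sumrB; ring.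
  have -> : (dt^-1 *: (phi' i - phi i) = G (mu i)) <->
      (phi' i = phi i + dt *: G (mu i)).
    split=> [<-|->].
      by rewrite scalerA divff ?gt_eqF// scale1r addrC subrK.
    by rewrite [phi i + _]addrC addrK scalerA mulVf ?gt_eqF// scale1r.
  rewrite GmuE /coupled; set M := mxact _ _ _; set S := \sum_(j < k) _ *: _.
  rewrite -[M + S + _]addrA [M + _]addrC !addrA.
  by split=> [->|<-]; rewrite ?addrK ?subrK.
split.
  move=> [phiE muE /rE r'E]; split => //; apply/funext => i.
  by apply/key.
move=> [phiE r'E muE]; split => //; last exact/rE.
by move=> i; apply/key => //; rewrite phiE.
Qed.
(** [lam i] is the quadratic form of [(dt / 2) d] at the [i]-th column of [E], which has norm 1 and
    so is nonzero. *)
Lemma positive_eigenvalues dt (E : 'M[R]_k) lam :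
  0 < dt -> positive_definite d ->
  orthogonally_diagonalizes ((dt / 2) *: d) E lam -> forall i, 0 < lam i.
Proof.
move=> dt0 hdpos [EtE dE] i; pose x := col i E.
have x0 : x != 0.
  apply: contra_eq_neq EtE => xE; apply/eqP => /matrixP/(_ i i).
  rewrite !mxE eqxx big1 => [/esym/eqP|j _]; first by rewrite oner_eq0.
  by move/colP: xE => /(_ j); rewrite !mxE => ->; rewrite mulr0.
have : 0 < dt / 2 * (x^T *m d *m x) 0 0 by rewrite !mulr_gt0 ?hdpos ?invr_gt0.
have -> : dt / 2 * (x^T *m d *m x) 0 0 = (x^T *m ((dt / 2) *: d) *m x) 0 0.
  by rewrite -scalemxAr -scalemxAl !mxE.
have -> : x^T *m ((dt / 2) *: d) *m x = col i (row i (diag_mx (\row_i lam i))).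
  rewrite /x rowE !colE trmx_mul trmx_delta dE -!mulmxA.
  by rewrite (mulmxA E^T E) EtE mul1mx (mulmxA E^T E) EtE mul1mx.
by rewrite !mxE eqxx.
Qed.

Lemma sav_cn_solution dt phib phi r (E : 'M[R]_k) lam (psi1 psi2 : 'I_k -> V) :
  (forall (lam : R) (g : V), 0 < lam ->
    exists! psi : V, psi - lam *: G (L psi) = g) ->
  0 < dt -> orthogonally_diagonalizes ((dt / 2) *: d) E lam ->
  (forall i, 0 < lam i) ->
  (forall i, psi1 i - lam i *: G (L (psi1 i)) =
    rhs1 Omega nu ev G L d E1 U dt phib phi r E i) ->
  (forall i, psi2 i - lam i *: G (L (psi2 i)) = rhs2 G E1 U dt phib E i) ->
  let den := coef_den Omega nu ev E1 U phib E psi2 in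
  let s := coef_num Omega nu ev E1 U phib E psi1 / den in
  den != 0 /\
  forall (phi' mu : 'I_k -> V) (r' : R),
  sav_cn Omega nu ev G L d E1 U dt phib phi r phi' mu r' <->
  [/\ forall i, phi' i = mxact E psi1 i + s *: mxact E psi2 i,
      r' = r + inner_sum Omega nu ev (half_b E1 U phib)
                 (fun j => phi' j - phi j) &
      forall i, mu i =
        2^-1 *: \sum_(j < k) d i j *: L (phi' j + phi j)
        + (r' + r) *: half_b E1 U phib i].
Proof.
move=> hsolv dt0 diagD lam0 psi1E psi2E den s.
have sys1 := decoupled_solves diagD psi1E.
have sys2 := decoupled_solves diagD psi2E.
have den0 : den != 0.
  have := inner_coupled_le0 oOmega hV hGneg hLpos diagD lam0 dt0 sys2.
  by rewrite /den /coef_den => le0; apply: lt0r_neq0; lra.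
split => // phi' mu r'.
have sysE (a : R) i : coupled G L ((dt / 2) *: d)
    (fun j => mxact E psi1 j + a *: mxact E psi2 j) i =
    phi i + \sum_(j < k) (dt / 2 * d i j) *: G (L (phi j))
    + (dt * (2 * r - \sum_(j < k) ip (half_b E1 U phib j) (phi j)))
        *: G (half_b E1 U phib i)
    + a *: (dt *: G (half_b E1 U phib i)).
  by rewrite coupledDZ sys1 sys2.
(* The pairing of [b] with the candidate is affine in its coefficient [a], so the self-consistency
   condition for [a] is a scalar linear equation with leading coefficient [den]. *)
have sumE (a : R) : \sum_(j < k) ip (half_b E1 U phib j)
    (mxact E psi1 j + a *: mxact E psi2 j) =
    coef_num Omega nu ev E1 U phib E psi1 + a * (1 - den).
  rewrite /den /coef_den subKr mulr_sumr -big_split; apply: eq_bigr => j _ /=.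
  by rewrite (innerDr oOmega hV) (innerZr oOmega hV).
apply: iff_trans (sav_cn_coupled _ _ _ _ _ _ dt0) _.
split=> [[phiE r'E muE]|[/funext phiE r'E muE]]; split=> //.
  pose s' := \sum_(j < k) ip (half_b E1 U phib j) (phi' j).
  have {}phiE : phi' = (fun j => mxact E psi1 j + s' *: mxact E psi2 j).
    apply: (coupled_inj hsolv diagD lam0); rewrite phiE.
    by apply/funext => i; rewrite sysE.
  suff -> : s = s' by move=> i; rewrite {1}phiE.
  have : s' = coef_num Omega nu ev E1 U phib E psi1 + s' * (1 - den).
    by rewrite -sumE {1}/s' phiE.
  rewrite /s => H; apply: (mulIf den0); rewrite divfK//.
  by move: H; rewrite mulrBr mulr1; lra.
rewrite {1}phiE; apply/funext => i; rewrite sysE phiE sumE; congr (_ + _ *: _).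
by rewrite /s; field.
Qed.
End Scheme.

(** * Lipschitz estimates for the nonlinear term *)

Lemma is_derive_translate (R : realType) (f : R -> R^o) (x df : R) :
  is_derive (0 : R) (1 : R) (fun e => f (x + e) : R^o) df ->
  is_derive x (1 : R) f df.
Proof.
have quotE : (fun h : R => h^-1 *:
     (((fun e => f (x + e) : R^o) \o shift 0) (h *: (1 : R)) - f (x + 0)))
   = (fun h : R => h^-1 *: ((f \o shift x) (h *: (1 : R)) - f x)).
  by apply/funext => h /=; rewrite !addr0 (addrC x).
move=> [fx fE]; split; first by move: fx; rewrite /derivable quotE.
by move: fE; rewrite /derive quotE.
Qed.

Section Lipschitz.
Variables (R : realType) (m : nat) (Omega : set 'rV[R]_m).
Variables (nu : {measure set (borel_rV R m) -> \bar R}).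
Variables (V : normedModType R) (ev : V -> 'rV[R]_m -> R).
Hypotheses (oOmega : open Omega) (hV : function_space Omega nu ev).
Variables (k : nat) (E1 : ('I_k -> V) -> R) (C1 : R).
Hypotheses (hC1 : 0 < C1) (hE1 : forall phi, C1 <= E1 phi).
Variable U : 'I_k -> ('I_k -> V) -> V.
Hypotheses (hU : is_variational_derivative Omega nu ev E1 U)
  (hUlip : forall i, locally_lipschitz_L2 Omega nu ev (U i)).
Local Notation ip := (inner Omega nu ev).
Local Notation nrm := (L2norm Omega nu ev).
Implicit Types (phi eta : 'I_k -> V).

Local Notation dist phi eta := (\sum_(j < k) `|phi j - eta j|).

Let dist_ge0 phi eta : 0 <= dist phi eta. Proof. exact: sumr_ge0. Qed.

Lemma U_lipschitz phi : exists rho K : R, [/\ 0 < rho, 0 <= K &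
  forall i (phi1 phi2 : 'I_k -> V),
    (forall j, `|phi1 j - phi j| < rho) ->
    (forall j, `|phi2 j - phi j| < rho) ->
    nrm (U i phi1 - U i phi2) <= K * dist phi1 phi2].
Proof.
have /choice[rho /choice[K rhoK]] i := hUlip i phi.
(* One radius and one constant for all components; the default [1] keeps the minimum positive. *)
exists (\big[Num.min/1]_i rho i), (\sum_i `|K i|); split.
- by elim/big_ind : _ => // [x y x0 y0|i _]; [rewrite lt_min x0|case: (rhoK i)].
- exact: sumr_ge0.
- move=> i phi1 phi2 h1 h2; have [_ /(_ phi1 phi2)] := rhoK i.
  have rho_i : \big[Num.min/1]_i rho i <= rho i by exact: bigmin_le_cond.
  move=> /(_ (fun j => lt_le_trans (h1 j) rho_i)).
  move=> /(_ (fun j => lt_le_trans (h2 j) rho_i)).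
  move=> /le_trans; apply; apply: ler_wpM2r; first exact: dist_ge0.
  rewrite (le_trans (ler_norm _))// (bigD1 i)//= lerDl; exact: sumr_ge0.
Qed.

Lemma U_bounded phi : exists rho B : R, [/\ 0 < rho, 0 <= B &
  forall i (phi1 : 'I_k -> V),
    (forall j, `|phi1 j - phi j| < rho) -> nrm (U i phi1) <= B].
Proof.
have [rho [K [rho0 K0 H]]] := U_lipschitz phi.
have B0 : 0 <= \sum_i nrm (U i phi).
  by apply: sumr_ge0 => i _; exact: L2norm_ge0.
exists rho, (\sum_i nrm (U i phi) + K * (k%:R * rho)); split => //.
  by rewrite addr_ge0// !mulr_ge0// ltW.
move=> i phi1 h1; rewrite -[U i phi1](subrK (U i phi)) addrC.
rewrite (le_trans (L2normD oOmega hV _ _))// lerD//.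
  by rewrite (bigD1 i)//= lerDl; apply: sumr_ge0 => j _; exact: L2norm_ge0.
have h j : `|phi j - phi j| < rho by rewrite subrr normr0.
rewrite (le_trans (H i _ _ h1 h))// ler_wpM2l//.
rewrite (le_trans (ler_sum _ (fun j _ => ltW (h1 j))))//.
by rewrite sumr_const card_ord mulr_natl.
Qed.

Let update phi i (v : V) j := if j == i then phi j + v else phi j.

Let update0 phi i : update phi i 0 = phi.
Proof. by apply/funext => j; rewrite /update addr0 if_same. Qed.

(** [hU] differentiates at [eps = 0] only. Taking the displaced point as new base point and
    translating gives the derivative at every [t]. *)
Let E1_derive phi i (v : V) (t : R) :
  is_derive t (1 : R) (fun s : R => E1 (update phi i (s *: v)) : R^o)
    (ip (U i (update phi i (t *: v))) v).
Proof.
apply: is_derive_translate.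
have := hU (update phi i (t *: v)) i v.
congr is_derive; apply/funext => e; congr E1; apply/funext => j.
by rewrite /update; case: (j == i) => //; rewrite scalerDl addrA.
Qed.

(** By convexity of balls the segment stays where [U i] is bounded by [B]; Cauchy-Schwarz bounds the
    derivative along it by [B] times the [L2norm] of [v]. *)
Let E1_update phi i (v : V) (B C rho : R) (phi1 : 'I_k -> V) : 0 <= B ->
  (forall f, nrm f <= C * `|f|) ->
  (forall phi1 : 'I_k -> V,
    (forall j, `|phi1 j - phi j| < rho) -> nrm (U i phi1) <= B) ->
  (forall j, `|phi1 j - phi j| < rho) ->
  (forall j, `|update phi1 i v j - phi j| < rho) ->
  `|E1 (update phi1 i v) - E1 phi1| <= B * C * `|v|.
Proof.
move=> B0 hC hB h0 h1.
have seg (t : R) : 0 < t < 1 ->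
    forall j, `|update phi1 i (t *: v) j - phi j| < rho.
  move=> /andP[t0 t1] j; have := h1 j; have := h0 j; rewrite /update.
  case: (j == i) => // a0 a1.
  have -> : phi1 j + t *: v - phi j =
      (1 - t) *: (phi1 j - phi j) + t *: (phi1 j + v - phi j).
    rewrite [phi1 j + v - _]addrAC [t *: (_ + v)]scalerDr addrA -scalerDl.
    by rewrite subrK scale1r addrAC.
  have t1' : 0 < 1 - t by rewrite subr_gt0.
  rewrite (le_lt_trans (ler_normD _ _))// !normrZ !gtr0_norm//; nra.
have := @mean_value_inequality R R^o
  (fun s : R => E1 (update phi1 i (s *: v))) 0 1 (B * C * `|v|) ler01.
rewrite scale1r scale0r update0 subr0 mulr1; apply.
- apply: derivable_within_continuous => t _; case: (E1_derive phi1 i v t) => //.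
- by move=> t _; case: (E1_derive phi1 i v t).
- move=> t /seg ht; have [_ ->] := E1_derive phi1 i v t.
  rewrite (le_trans (Cauchy_Schwarz oOmega hV _ _))// -mulrA.
  by apply: ler_pM; rewrite ?L2norm_ge0// hB.
Qed.

Lemma E1_lipschitz phi : exists rho K : R, [/\ 0 < rho, 0 <= K &
  forall phi1 phi2 : 'I_k -> V,
    (forall j, `|phi1 j - phi j| < rho) ->
    (forall j, `|phi2 j - phi j| < rho) ->
    `|E1 phi1 - E1 phi2| <= K * dist phi1 phi2].
Proof.
have [rho [B [rho0 B0 hB]]] := U_bounded phi.
have [C C0 hC] := L2norm_dominated hV.
exists rho, (B * C); split; rewrite ?mulr_ge0// => phi1 phi2 h1 h2.
(* Only partial derivatives of [E1] are available, so [phi2] is turned into [phi1] one argument at a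
   time; [h l] has its first [l] arguments replaced. *)
pose h (l : nat) (j : 'I_k) := if (j < l)%N then phi1 j else phi2 j.
have hE : E1 phi1 - E1 phi2 = \sum_(l < k) (E1 (h l.+1) - E1 (h l)).
  rewrite -(big_mkord xpredT (fun l => E1 (h l.+1) - E1 (h l))).
  rewrite telescope_sumr//.
  by congr (E1 _ - E1 _); apply/funext => j; rewrite /h ?ltn_ord.
have hh l j : `|h l j - phi j| < rho by rewrite /h; case: ifP.
rewrite hE (le_trans (ler_norm_sum _ _ _))// mulr_sumr ler_sum// => l _.
have -> : h l.+1 = update (h l) l (phi1 l - phi2 l).
  apply/funext => j; rewrite /update /h ltnS leq_eqVlt -val_eqE /=.
  case: eqP => [/val_inj ->|_]; last by [].
  by rewrite ltnn addrC subrK.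
apply: (@E1_update phi l _ B C rho) => //; first exact: hB.
move=> j; have := hh l.+1 j; rewrite /update /h ltnS leq_eqVlt -val_eqE /=.
case: eqP => [/val_inj ->|_]; last by [].
by rewrite ltnn addrC [_ + (_ - _)]addrC subrK addrC.
Qed.

Let sqrtC1 : 0 < Num.sqrt C1. Proof. by rewrite sqrtr_gt0. Qed.

Let inv_sqrt_le (x : R) : C1 <= x ->
  `|(2 * Num.sqrt x)^-1| <= (2 * Num.sqrt C1)^-1.
Proof.
move=> hx; have sx : Num.sqrt C1 <= Num.sqrt x by rewrite ler_wsqrtr.
have sx0 := lt_le_trans sqrtC1 sx.
rewrite ger0_norm ?invr_ge0 ?mulr_ge0 ?sqrtr_ge0//.
by rewrite lef_pV2 ?posrE ?mulr_gt0// ler_pM2l.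
Qed.

(** With [a], [b] the two roots, the left side is [|x - y| / (2 a b (a + b))], and both roots are at
    least [Num.sqrt C1]. *)
Let inv_sqrt_lipschitz (x y : R) : C1 <= x -> C1 <= y ->
  `|(2 * Num.sqrt x)^-1 - (2 * Num.sqrt y)^-1|
    <= (4 * C1 * Num.sqrt C1)^-1 * `|x - y|.
Proof.
move=> hx hy.
have sx : Num.sqrt C1 <= Num.sqrt x by rewrite ler_wsqrtr.
have sy : Num.sqrt C1 <= Num.sqrt y by rewrite ler_wsqrtr.
have sx0 := lt_le_trans sqrtC1 sx; have sy0 := lt_le_trans sqrtC1 sy.
have -> : x - y = (Num.sqrt x - Num.sqrt y) * (Num.sqrt x + Num.sqrt y).
  by rewrite -subr_sqr !sqr_sqrtr ?(le_trans (ltW hC1)).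
move: sx0 sy0 sx sy; move: (Num.sqrt x) (Num.sqrt y) => a b a0 b0 ca cb.
have -> : (2 * a)^-1 - (2 * b)^-1 = - (2 * a * b)^-1 * (a - b).
  by field; rewrite !gt_eqF.
rewrite !normrM mulrCA mulrC ler_wpM2l// normrN.
rewrite !gtr0_norm ?addr_gt0 ?invr_gt0 ?mulr_gt0//.
rewrite ler_pdivlMl ?mulr_gt0// ler_pdivrMr ?mulr_gt0//.
rewrite -[C1 in leLHS](sqr_sqrtr (ltW hC1)).
move: sqrtC1 ca cb; move: (Num.sqrt C1) => c c0 ca cb.
rewrite sqrtr_sqr gtr0_norm//.
have -> : 4 * c ^+ 2 * c = 2 * (c * c * (c + c)) by ring.
have -> : (a + b) * (2 * a * b) = 2 * (a * b * (a + b)) by ring.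
rewrite ler_pM2l//; apply: ler_pM; last exact: lerD.
- by rewrite mulr_ge0 ?ltW.
- by rewrite addr_ge0 ?ltW.
- by apply: ler_pM => //; exact: ltW.
Qed.

Local Notation b := (half_b E1 U).

Lemma half_b_lipschitz phi : exists rho K : R, [/\ 0 < rho, 0 <= K &
  forall i (phi1 phi2 : 'I_k -> V),
    (forall j, `|phi1 j - phi j| < rho) ->
    (forall j, `|phi2 j - phi j| < rho) ->
    nrm (b phi1 i) <= K /\ nrm (b phi1 i - b phi2 i) <= K * dist phi1 phi2].
Proof.
have [rho1 [K1 [rho10 K10 hK1]]] := U_lipschitz phi.
have [rho2 [B [rho20 B0 hB]]] := U_bounded phi.
have [rho3 [K3 [rho30 K30 hK3]]] := E1_lipschitz phi.
pose rho := Num.min rho1 (Num.min rho2 rho3).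
pose A := (2 * Num.sqrt C1)^-1; pose A' := (4 * C1 * Num.sqrt C1)^-1.
have A0 : 0 <= A by rewrite invr_ge0 mulr_ge0// sqrtr_ge0.
have A'0 : 0 <= A' by rewrite invr_ge0 !mulr_ge0// ?ltW.
(* [A * B] bounds the norm and the bracket is the Lipschitz constant from the product rule; the sum
   serves for both. *)
exists rho, (A * B + (A * K1 + A' * K3 * B)); split.
- by rewrite !lt_min rho10 rho20.
- by rewrite !addr_ge0 ?mulr_ge0.
move=> i phi1 phi2 h1 h2.
have rhoE x : x < rho -> [/\ x < rho1, x < rho2 & x < rho3].
  by rewrite !lt_min => /and3P[].
have h11 j : `|phi1 j - phi j| < rho1 by case: (rhoE _ (h1 j)).
have h12 j : `|phi1 j - phi j| < rho2 by case: (rhoE _ (h1 j)).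
have h13 j : `|phi1 j - phi j| < rho3 by case: (rhoE _ (h1 j)).
have h21 j : `|phi2 j - phi j| < rho1 by case: (rhoE _ (h2 j)).
have h22 j : `|phi2 j - phi j| < rho2 by case: (rhoE _ (h2 j)).
have h23 j : `|phi2 j - phi j| < rho3 by case: (rhoE _ (h2 j)).
split.
  rewrite /half_b (L2normZ oOmega hV) (@le_trans _ _ (A * B))//.
    by apply: ler_pM; rewrite ?L2norm_ge0 ?inv_sqrt_le ?hB.
  by rewrite lerDl addr_ge0 ?mulr_ge0.
have -> : b phi1 i - b phi2 i =
    (2 * Num.sqrt (E1 phi1))^-1 *: (U i phi1 - U i phi2)
    + ((2 * Num.sqrt (E1 phi1))^-1 - (2 * Num.sqrt (E1 phi2))^-1) *: U i phi2.
  by rewrite /half_b scalerBr scalerBl addrA subrK.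
rewrite (le_trans (L2normD oOmega hV _ _))// !(L2normZ oOmega hV).
rewrite (@le_trans _ _ ((A * K1 + A' * K3 * B) * dist phi1 phi2))//; last first.
  by rewrite ler_wpM2r ?dist_ge0// lerDr mulr_ge0.
rewrite [leRHS]mulrDl lerD//.
  rewrite -mulrA; apply: ler_pM; rewrite ?L2norm_ge0 ?inv_sqrt_le//; exact: hK1.
rewrite mulrAC; apply: ler_pM; rewrite ?L2norm_ge0 ?hB//.
rewrite (le_trans (inv_sqrt_lipschitz _ _))//.
by rewrite -[leRHS]mulrA ler_wpM2l// hK3.
Qed.

(* Compactness of the trajectory makes the local constants uniform in time. *)
Lemma half_b_lipschitz_trajectory (T : R) (phi : 'I_k -> R -> V) :
  (forall j, {within `[0, T], continuous (phi j)}) ->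
  exists2 N : R, 0 < N & forall t, 0 <= t <= T ->
    forall i (phi1 : 'I_k -> V), (forall j, `|phi1 j - phi j t| < N^-1) ->
    nrm (b phi1 i) <= N /\
    nrm (b phi1 i - b (phi ^~ t) i) <= N * dist phi1 (phi ^~ t).
Proof.
move=> cphi.
(* [N] is at once the bound, the Lipschitz constant and the inverse of the radius. The local
   property then holds for all large [N], the form in which near-covering compactness applies. *)
pose P (N t : R) := forall i (phi1 : 'I_k -> V),
  (forall j, `|phi1 j - phi j t| < N^-1) ->
    nrm (b phi1 i) <= N /\
    nrm (b phi1 i - b (phi ^~ t) i) <= N * dist phi1 (phi ^~ t).
suff PN : \forall N \near +oo, `[0, T] `<=` P N.
  have [N [N0 HN]] := @filter_ex _ (pinfty_nbhs R) _ _
    (filterI (nbhs_pinfty_gt (num_real (0 : R))) PN).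
  by exists N => // t tT; apply: HN; rewrite /= in_itv.
have [/(_ (@segment_compact _ _ _)) + _] := compact_near_coveringP `[0, T].
move=> /near_covering_withinP; apply => t0 t0T.
have [rho [K [rho0 K0 H]]] := half_b_lipschitz (phi ^~ t0).
near=> t N => tT i phi1 h1.
have tclose : [set` `[0, T]] t -> forall j, `|phi j t - phi j t0| < rho / 2.
  near: t; apply: (@filter_forall _ _ _ (within [set` `[0, T]] (nbhs t0))) => j.
  apply: cvgr_distC_lt; last by rewrite divr_gt0.
  by have /subspace_continuousP := cphi j; exact.
have {}tclose := tclose tT.
have NK : K <= N by near: N; apply: nbhs_pinfty_ge; exact: num_real.
have Nrho : N^-1 <= rho / 2.
  have N0 : (rho / 2)^-1 <= N.
    by near: N; apply: nbhs_pinfty_ge; exact: num_real.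
  have N1 : 0 < (rho / 2)^-1 by rewrite invr_gt0 divr_gt0.
  by rewrite -[leRHS]invrK lef_pV2 ?posrE// (lt_le_trans N1).
have hphi1 j : `|phi1 j - phi j t0| < rho.
  rewrite -(subrK (phi j t) (phi1 j)) -addrA [rho]splitr.
  rewrite (le_lt_trans (ler_normD _ _))// ltrD//.
  exact: lt_le_trans (h1 j) Nrho.
have hphi j : `|phi j t - phi j t0| < rho.
  by rewrite (lt_trans (tclose j))// ltr_pdivrMr// ltr_pMr// ltr1n.
have [le1 le2] := H i phi1 (phi ^~ t) hphi1 hphi; split.
  exact: le_trans NK.
by rewrite (le_trans le2)// ler_wpM2r ?dist_ge0.
Unshelve. all: by end_near.
Qed.

End Lipschitz.

(** * Consistency *)

Section SecondOrder.
Variables (R : realType) (T : R).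
Implicit Types e g : R -> nat -> R.

Lemma second_order_le e g (delta : R) : 0 < delta ->
  (forall dt n, 0 < dt < delta -> n.+1%:R * dt <= T -> `|e dt n| <= g dt n) ->
  second_order T g -> second_order T e.
Proof.
move=> delta0 eg [C [delta' [delta'0 gC]]].
exists C, (Num.min delta delta'); split=> [|dt n].
  by rewrite lt_min delta0.
rewrite lt_min => /and3P[dt0 dtd dtd'] ndt.
have := gC dt n; have := eg dt n; rewrite dt0 dtd dtd'.
move=> /(_ isT ndt) h /(_ isT ndt).
apply: le_trans; exact: le_trans (ler_norm _).
Qed.

Lemma second_order_bound e (C : R) :
  (forall dt n, 0 < dt -> n.+1%:R * dt <= T -> `|e dt n| <= C * dt ^+ 2) ->
  second_order T e.
Proof. by move=> eC; exists C, 1; split => // dt n /andP[dt0 _]; exact: eC. Qed.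

Lemma second_orderD e g : second_order T e -> second_order T g ->
  second_order T (fun dt n => e dt n + g dt n).
Proof.
move=> [C [delta [delta0 eC]]] [C' [delta' [delta'0 gC]]].
exists (C + C'), (Num.min delta delta'); split=> [|dt n].
  by rewrite lt_min delta0.
rewrite lt_min => /and3P[dt0 dtd dtd'] ndt.
have := gC dt n; have := eC dt n; rewrite dt0 dtd dtd'.
move=> /(_ isT ndt) h /(_ isT ndt) h'.
by rewrite (le_trans (ler_normD _ _))// mulrDl lerD.
Qed.

Lemma second_orderM (a : R) e : second_order T e ->
  second_order T (fun dt n => a * e dt n).
Proof.
move=> [C [delta [delta0 eC]]]; exists (`|a| * C), delta.
split=> // dt n hdt ndt.
by rewrite normrM -mulrA ler_wpM2l// eC.
Qed.

Lemma second_order_sum (I : Type) (s : seq I) (e : I -> R -> nat -> R) :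
  (forall i, second_order T (e i)) ->
  second_order T (fun dt n => \sum_(i <- s) e i dt n).
Proof.
move=> se; elim: s => [|i s IHs].
  by apply: (@second_order_bound _ 0) => dt n _ _; rewrite big_nil normr0 mul0r.
have -> : (fun dt n => \sum_(i <- i :: s) e i dt n) =
    (fun dt n => e i dt n + \sum_(i <- s) e i dt n).
  by apply/funext => dt; apply/funext => n; rewrite big_cons.
exact: second_orderD.
Qed.

Lemma second_order_small e (eta : R) : 0 < eta -> second_order T e ->
  exists2 delta, 0 < delta & forall dt n, 0 < dt < delta -> n.+1%:R * dt <= T ->
    `|e dt n| < eta.
Proof.
move=> eta0 [C [delta [delta0 eC]]].
have C0 : 0 < `|C| + 1 by rewrite ltr_wpDl.
(* With [dt < 1] one has [C dt^2 <= (|C| + 1) dt], which the last term of the minimum keeps below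
   [eta]. *)
exists (Num.min delta (Num.min 1 (eta / (`|C| + 1)))) => [|dt n].
  by rewrite !lt_min delta0 ltr01 divr_gt0.
rewrite !lt_min => /and4P[dt0 dtd dt1]; rewrite ltr_pdivlMr// => dteta ndt.
have := eC dt n; rewrite dt0 dtd => /(_ isT ndt) /le_lt_trans; apply.
apply: le_lt_trans dteta; rewrite expr2 mulrA mulrC ler_wpM2l ?(ltW dt0)//.
have := ler_norm C; have := normr_ge0 C; nra.
Qed.
End SecondOrder.

Section Consistency.
Variables (R : realType) (m : nat) (Omega : set 'rV[R]_m).
Variables (nu : {measure set (borel_rV R m) -> \bar R}).
Variables (V : normedModType R) (ev : V -> 'rV[R]_m -> R).
Hypotheses (oOmega : open Omega) (hV : function_space Omega nu ev).
Variables (k : nat) (G L : {linear V -> V}) (d : 'M[R]_k).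
Variables (E1 : ('I_k -> V) -> R) (C1 : R).
Hypotheses (hC1 : 0 < C1) (hE1 : forall phi, C1 <= E1 phi).
Variable U : 'I_k -> ('I_k -> V) -> V.
Hypotheses (hU : is_variational_derivative Omega nu ev E1 U)
  (hUlip : forall i, locally_lipschitz_L2 Omega nu ev (U i)).
Local Notation ip := (inner Omega nu ev).
Local Notation nrm := (L2norm Omega nu ev).
Local Notation b := (half_b E1 U).

Variables (T : R) (phi mu : 'I_k -> R -> V) (r : R -> R)
  (phib : R -> nat -> 'I_k -> V).
Hypotheses (T0 : 0 < T)
  (flow : reformulated_flow Omega nu ev G L d E1 U T phi mu r)
  (phi_smooth : forall i, smooth_in_time 3 T (phi i))
  (Lphi_smooth : forall i, smooth_in_time 2 T (fun t => L (phi i t)))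
  (r_smooth : smooth_in_time 3 T (r : R -> R^o))
  (phib_second_order : forall j, second_order T (fun dt n =>
        `|phib dt n j - phi j ((n%:R + 2^-1) * dt)|)).

Local Notation mid dt n := ((n%:R + 2^-1) * dt).

Lemma phi_derive t i : 0 < t < T -> derive1 (phi i) t = G (mu i t).
Proof. by move=> /flow[/(_ i)[_ +] _ _]; rewrite derive1E. Qed.

Lemma residual_phi_second_order i : second_order T (fun dt n => nrm
  (residual_phi G dt
     (fun j => phi j (n%:R * dt)) (fun j => phi j (n.+1%:R * dt))
     (fun j => mu j (mid dt n)) i)).
Proof.
have [C C0 hC] := L2norm_dominated hV.
have [M M0 hM] := central_difference (phi_smooth i).
apply: (@second_order_bound _ _ _ (C * M)) => dt n dt0 ndt.
have [cT _ _ _ _] := time_step dt0 ndt.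
rewrite ger0_norm ?L2norm_ge0// (le_trans (hC _))// -mulrA ler_wpM2l//.
by rewrite /residual_phi -phi_derive// hM.
Qed.

(** For small [dt] the extrapolation [phib] enters the tube of radius [N^-1] around the trajectory,
    where the uniform constants hold. *)
Lemma half_b_error : exists N delta : R, [/\ 0 < N, 0 < delta &
  forall dt n, 0 < dt < delta -> n.+1%:R * dt <= T -> forall i,
    nrm (b (phib dt n) i) <= N /\
    nrm (b (phib dt n) i - b (phi ^~ (mid dt n)) i)
      <= N * \sum_(j < k) `|phib dt n j - phi j (mid dt n)|].
Proof.
have [N N0 hN] := half_b_lipschitz_trajectory oOmega hV hC1 hE1 hU hUlip
  (fun j => let: And3 c _ _ := phi_smooth j in c).
have Ninv : 0 < N^-1 by rewrite invr_gt0.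
have [delta delta0 hd] := second_order_small Ninv
  (second_order_sum (index_enum _) phib_second_order).
exists N, delta; split => // dt n hdt ndt i.
have [/andP[c0 cT] _ _ _ _] := time_step (proj1 (andP hdt)) ndt.
apply: hN => [|j]; first by rewrite !ltW.
apply: le_lt_trans (hd dt n hdt ndt).
rewrite [leRHS]ger0_norm ?sumr_ge0//.
by rewrite (bigD1 j)//= lerDl sumr_ge0.
Qed.

Let so_phib := second_order_sum (index_enum 'I_k) phib_second_order.

Lemma residual_mu_second_order i : second_order T (fun dt n => nrm
  (residual_mu L d E1 U (phib dt n)
     (fun j => phi j (n%:R * dt)) (fun j => phi j (n.+1%:R * dt))
     (fun j => mu j (mid dt n)) (r (n%:R * dt)) (r (n.+1%:R * dt)) i)).
Proof.
have [C C0 hC] := L2norm_dominated hV.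
have [N [delta [N0 delta0 hN]]] := half_b_error.
have r2 := smooth_in_time_pred r_smooth.
have [Mr Mr0 hr] := smooth_in_time_bound T0 (smooth_in_time_pred r2).
have [M M0 hM] := midpoint_average T0 r2.
pose eL j dt n := `|L (phi j (n.+1%:R * dt)) + L (phi j (n%:R * dt))
                    - 2 *: L (phi j (mid dt n))|.
have soL j : second_order T (eL j).
  have [ML _ hML] := midpoint_average T0 (Lphi_smooth j).
  apply: (@second_order_bound _ _ _ ML) => dt n *; rewrite normr_id.
  exact: hML.
pose er dt n := `|r (n.+1%:R * dt) + r (n%:R * dt) - 2 * r (mid dt n)|.
have sor : second_order T er.
  apply: (@second_order_bound _ _ _ M) => dt n *; rewrite normr_id.
  exact: hM.
have := second_orderD
  (second_order_sum (index_enum 'I_k)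
     (fun j => second_orderM (2^-1 * `|d i j| * C) (soL j)))
  (second_orderD (second_orderM (2 * Mr * N) so_phib) (second_orderM N sor)).
apply: (second_order_le delta0) => dt n hdt ndt.
rewrite ger0_norm ?L2norm_ge0//.
have [cT _ _ _ _] := time_step (proj1 (andP hdt)) ndt.
have [b1 b2] := hN dt n hdt ndt i.
set t := mid dt n in cT b2 *.
(* Inserting [2 r(t)] times [b] at [phib] separates three errors: averaging of [L phi], replacing
   the exact argument of [b] by [phib], and averaging of [r]. They match the three majorants above;
   the equation for [mu] holds exactly at [t], where [U / sqrt E1] is twice [b]. *)
have -> : residual_mu L d E1 U (phib dt n)
     (fun j => phi j (n%:R * dt)) (fun j => phi j (n.+1%:R * dt))
     (fun j => mu j t) (r (n%:R * dt)) (r (n.+1%:R * dt)) i =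
   - \sum_(j < k) (2^-1 * d i j) *: (L (phi j (n.+1%:R * dt))
       + L (phi j (n%:R * dt)) - 2 *: L (phi j t))
   + (- (2 * r t) *: (b (phib dt n) i - b (phi ^~ t) i)
     - (r (n.+1%:R * dt) + r (n%:R * dt) - 2 * r t) *: b (phib dt n) i).
  have [_ muE _] := flow cT.
  have -> : - \sum_(j < k) (2^-1 * d i j) *: (L (phi j (n.+1%:R * dt))
        + L (phi j (n%:R * dt)) - 2 *: L (phi j t)) =
      \sum_(j < k) d i j *: L (phi j t)
      - 2^-1 *: \sum_(j < k)
          d i j *: L (phi j (n.+1%:R * dt) + phi j (n%:R * dt)).
    rewrite scaler_sumr -sumrB -sumrN; apply: eq_bigr => j _.
    rewrite [L (_ + _)]linearD scalerBr opprB !scalerA; congr (_ *: _ - _).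
    by field.
  have -> : - (2 * r t) *: (b (phib dt n) i - b (phi ^~ t) i)
     - (r (n.+1%:R * dt) + r (n%:R * dt) - 2 * r t) *: b (phib dt n) i =
     (r t / Num.sqrt (E1 (phi ^~ t))) *: U i (phi ^~ t)
     - (r (n.+1%:R * dt) + r (n%:R * dt)) *: b (phib dt n) i.
    rewrite scaleNr scalerBr opprB scalerBl opprB addrA subrK; congr (_ - _).
    rewrite /half_b scalerA; congr (_ *: _).
    by field; rewrite gt_eqF// sqrtr_gt0 (lt_le_trans hC1).
  by rewrite /residual_mu muE opprD addrACA.
rewrite (le_trans (L2normD oOmega hV _ _))// lerD//.
  rewrite (L2normN oOmega hV) (le_trans (L2norm_sum oOmega hV _ _))//.
  apply: ler_sum => j _.
  rewrite (L2normZ oOmega hV) normrM (ger0_norm (_ : 0 <= 2^-1)) ?invr_ge0//.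
  by rewrite -[leRHS]mulrA ler_wpM2l ?mulr_ge0 ?invr_ge0.
rewrite (le_trans (L2normD oOmega hV _ _))// lerD//.
  rewrite (L2normZ oOmega hV) -[leRHS]mulrA ler_pM ?L2norm_ge0//.
  rewrite normrN normrM ger0_norm// ler_wpM2l// hr//.
  by move: cT => /andP[? ?]; rewrite !ltW.
by rewrite (L2normN oOmega hV) (L2normZ oOmega hV) mulrC ler_wpM2r.
Qed.

Lemma residual_r_second_order : second_order T (fun dt n =>
  residual_r Omega nu ev E1 U dt (phib dt n)
    (fun j => phi j (n%:R * dt)) (fun j => phi j (n.+1%:R * dt))
    (r (n%:R * dt)) (r (n.+1%:R * dt))).
Proof.
have [C C0 hC] := L2norm_dominated hV.
have [N [delta [N0 delta0 hN]]] := half_b_error.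
have [Mr _ hMr] := central_difference r_smooth.
pose er dt n := dt^-1 * (r (n.+1%:R * dt) - r (n%:R * dt))
  - derive1 (r : R -> R^o) (mid dt n).
have sor : second_order T er by exact: second_order_bound hMr.
pose ephi j dt n := `|dt^-1 *: (phi j (n.+1%:R * dt) - phi j (n%:R * dt))
  - derive1 (phi j) (mid dt n)|.
have sophi j : second_order T (ephi j).
  have [M _ hM] := central_difference (phi_smooth j).
  apply: (@second_order_bound _ _ _ M) => dt n *; rewrite normr_id.
  exact: hM.
have /choice[B hB] j :
    exists B, forall t, 0 < t < T -> `|derive1 (phi j) t| <= B.
  have [B _ hB] := smooth_in_time_bounded
    (smooth_in_time_pred (smooth_in_time_pred (phi_smooth j))).
  by exists B.
have so_abs e : second_order T e -> second_order T (fun dt n => `|e dt n|).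
  move=> [Ce [de [de0 He]]]; exists Ce, de; split => // dt n *.
  by rewrite normr_id; exact: He.
have := second_orderD (so_abs _ sor) (second_orderD
  (second_order_sum (index_enum 'I_k)
     (fun j => second_orderM (N * C * B j) so_phib))
  (second_order_sum (index_enum 'I_k)
     (fun j => second_orderM (N * C) (sophi j)))).
apply: (second_order_le delta0) => dt n hdt ndt.
have [cT _ _ _ _] := time_step (proj1 (andP hdt)) ndt.
have dt0 := proj1 (andP hdt).
have {}hN i := hN dt n hdt ndt i.
set t := mid dt n in cT hN *.
(* Subtracting the exact equation for [r] at [t] leaves the difference-quotient error of [r], the
   error of [b] against the bounded derivative of [phi], and the bounded [b] against the
   difference-quotient error of [phi]. *)
have -> : residual_r Omega nu ev E1 U dt (phib dt n)
    (fun j => phi j (n%:R * dt)) (fun j => phi j (n.+1%:R * dt))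
    (r (n%:R * dt)) (r (n.+1%:R * dt)) =
   er dt n - (\sum_(j < k)
       ip (b (phib dt n) j - b (phi ^~ t) j) (derive1 (phi j) t)
     + \sum_(j < k) ip (b (phib dt n) j)
         (dt^-1 *: (phi j (n.+1%:R * dt) - phi j (n%:R * dt))
           - derive1 (phi j) t)).
  have [_ _ [_ rE]] := flow cT.
  rewrite /er -/t [derive1 _ t]derive1E rE /residual_r !(inner_sumE oOmega hV).
  rewrite -big_split /=.
  rewrite [_ / dt]mulrC -[RHS]addrA -opprD; congr (_ - _).
  rewrite mulr_sumr mulr_suml -big_split; apply: eq_bigr => j _ /=.
  set x := phi j (n.+1%:R * dt) - phi j (n%:R * dt); clearbody x.
  rewrite (innerBl oOmega hV) (innerBr oOmega hV) (innerZr oOmega hV).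
  rewrite /half_b (innerZl oOmega hV _ (U j (phi ^~ t))) div1r.
  ring.
rewrite (le_trans (ler_normB _ _))// lerD// (le_trans (ler_normD _ _))// lerD//.
  rewrite (le_trans (ler_norm_sum _ _ _))// ler_sum// => j _.
  rewrite (le_trans (Cauchy_Schwarz oOmega hV _ _))//.
  have [_ b2] := hN j.
  have -> : N * C * B j * \sum_i `|phib dt n i - phi i t| =
    N * (\sum_i `|phib dt n i - phi i t|) * (C * B j) by ring.
  apply: ler_pM; rewrite ?L2norm_ge0//.
  by rewrite (le_trans (hC _))// ler_wpM2l// hB.
rewrite (le_trans (ler_norm_sum _ _ _))// ler_sum// => j _.
rewrite (le_trans (Cauchy_Schwarz oOmega hV _ _))// -mulrA.
by have [b1 _] := hN j; apply: ler_pM; rewrite ?L2norm_ge0.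
Qed.

End Consistency.

Theorem theorem2p3 (R : realType) (m k : nat) (hm : (0 < m)%N) (hk : (0 < k)%N)
  (Omega : set 'rV[R]_m) (hOmega : is_domain Omega)
  (nu : {measure set (borel_rV R m) -> \bar R}) (hnu : is_lebesgue_measure nu)
  (V : normedModType R) (ev : V -> 'rV[R]_m -> R)
  (hV : function_space Omega nu ev)
  (G L : {linear V -> V})
  (hGsym : symmetric_op Omega nu ev G) (hGneg : nonpositive_op Omega nu ev G)
  (hLsym : symmetric_op Omega nu ev L) (hLpos : nonnegative_op Omega nu ev L)
  (d : 'M[R]_k) (hdsym : d^T = d) (hdpos : positive_definite d)
  (E1 : ('I_k -> V) -> R) (C1 : R) (hC1 : 0 < C1)
  (hE1 : forall phi, C1 <= E1 phi)
  (U : 'I_k -> ('I_k -> V) -> V)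
  (hU : is_variational_derivative Omega nu ev E1 U)
  (hUlip : forall i, locally_lipschitz_L2 Omega nu ev (U i))
  (hsolv : forall (lam : R) (g : V), 0 < lam ->
     exists! psi : V, psi - lam *: G (L psi) = g) :
  (* (1) second-order consistency *)
  (forall (T : R) (phi mu : 'I_k -> R -> V) (r : R -> R)
     (phib : R -> nat -> 'I_k -> V),
     0 < T ->
     reformulated_flow Omega nu ev G L d E1 U T phi mu r ->
     (forall i, smooth_in_time 3 T (phi i)) ->
     (forall i, smooth_in_time 2 T (fun t => L (phi i t))) ->
     smooth_in_time 3 T (r : R -> R^o) ->
     (forall j, second_order T (fun dt n =>
        `|phib dt n j - phi j ((n%:R + 2^-1) * dt)|)) ->
     [/\ forall i, second_order T (fun dt n =>
           L2norm Omega nu ev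
             (residual_phi G dt
                (fun j => phi j (n%:R * dt)) (fun j => phi j (n.+1%:R * dt))
                (fun j => mu j ((n%:R + 2^-1) * dt)) i)),
         forall i, second_order T (fun dt n =>
           L2norm Omega nu ev
             (residual_mu L d E1 U (phib dt n)
                (fun j => phi j (n%:R * dt)) (fun j => phi j (n.+1%:R * dt))
                (fun j => mu j ((n%:R + 2^-1) * dt))
                (r (n%:R * dt)) (r (n.+1%:R * dt)) i)) &
         second_order T (fun dt n =>
           residual_r Omega nu ev E1 U dt (phib dt n)
             (fun j => phi j (n%:R * dt)) (fun j => phi j (n.+1%:R * dt))
             (r (n%:R * dt)) (r (n.+1%:R * dt)))])
  /\
  (* (2) unconditional energy stability *)
  (forall (dt : R) (phib phi : 'I_k -> V) (r : R)
     (phi' mu : 'I_k -> V) (r' : R),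
     0 < dt ->
     sav_cn Omega nu ev G L d E1 U dt phib phi r phi' mu r' ->
     dt^-1 * sav_energy Omega nu ev L d phi' r'
       - dt^-1 * sav_energy Omega nu ev L d phi r
     = \sum_(i < k) inner Omega nu ev (G (mu i)) (mu i)
     /\ \sum_(i < k) inner Omega nu ev (G (mu i)) (mu i) <= 0)
  /\
  (* (3) solution by two sequences of decoupled linear equations *)
  (forall (dt : R) (phib phi : 'I_k -> V) (r : R), 0 < dt ->
     (exists (E : 'M[R]_k) (lam : 'I_k -> R),
        orthogonally_diagonalizes ((dt / 2) *: d) E lam) /\
     forall (E : 'M[R]_k) (lam : 'I_k -> R),
     orthogonally_diagonalizes ((dt / 2) *: d) E lam ->
     let g1 := rhs1 Omega nu ev G L d E1 U dt phib phi r E in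
     let g2 := rhs2 G E1 U dt phib E in
     [/\ forall i, 0 < lam i,
         forall i, exists! psi : V, psi - lam i *: G (L psi) = g1 i,
         forall i, exists! psi : V, psi - lam i *: G (L psi) = g2 i &
         forall psi1 psi2 : 'I_k -> V,
         (forall i, psi1 i - lam i *: G (L (psi1 i)) = g1 i) ->
         (forall i, psi2 i - lam i *: G (L (psi2 i)) = g2 i) ->
         let den := coef_den Omega nu ev E1 U phib E psi2 in
         let s := coef_num Omega nu ev E1 U phib E psi1 / den in
         den != 0 /\
         forall (phi' mu : 'I_k -> V) (r' : R),
         sav_cn Omega nu ev G L d E1 U dt phib phi r phi' mu r' <->
         [/\ forall i, phi' i = mxact E psi1 i + s *: mxact E psi2 i,
             r' = r + inner_sum Omega nu ev (half_b E1 U phib)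
                        (fun j => phi' j - phi j) &
             forall i, mu i =
               2^-1 *: \sum_(j < k) d i j *: L (phi' j + phi j)
               + (r' + r) *: half_b E1 U phib i]]).
Proof.
have oOmega : open Omega by case: hOmega.
split; [|split].
- move=> T phi mu r phib T0 flow phi_smooth Lphi_smooth r_smooth phib_so.
  split=> [i|i|].
  + exact: (residual_phi_second_order hV flow phi_smooth).
  + exact: (residual_mu_second_order oOmega hV hC1 hE1 hU hUlip T0 flow
      phi_smooth Lphi_smooth r_smooth phib_so).
  + exact: (residual_r_second_order oOmega hV hC1 hE1 hU hUlip flow
      phi_smooth r_smooth phib_so).
- move=> dt phib phi r phi' mu r' dt0 scheme; split.
    exact: (sav_cn_energy oOmega hV hLsym hdsym dt0 scheme).
  exact: inner_G_sum_le0.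
move=> dt phib phi r dt0; split.
  have [|E [lam [EtE dE]]] :=
      @real_symmetric_diagonalizable R k ((dt / 2) *: d).
    by rewrite linearZ /= hdsym.
  exists E, (lam 0); split=> //; rewrite dE; congr (_ *m diag_mx _ *m _).
  by apply/rowP => i; rewrite mxE.
move=> E lam diagD g1 g2.
have lam0 := positive_eigenvalues dt0 hdpos diagD.
split=> [//|i|i|psi1 psi2 psi1E psi2E]; [exact: hsolv|exact: hsolv|].
exact: (sav_cn_solution oOmega hV hGneg hLpos hsolv dt0 diagD lam0 psi1E psi2E).
Qed.
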